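(* Let $\Bbbk$ be a field and let $A=A_\mu(R,\boldsymbol\partial,\mathbf a)$ and $A'=A_{\mu'}(R',\boldsymbol\partial',\mathbf a')$ be twisted generalized Weyl Poisson algebras (TGWPAs) of type $(A_1)^n$ and $(A_1)^m$, respectively. (1) The tensor product $A\otimes_\Bbbk A'$ is (isomorphic as a Poisson algebra to) a TGWPA. (2) Let $\delta=\{\delta_{\boldsymbol\alpha}\mid\boldsymbol\alpha\in\mathbb Z^n\}$ be a diagonal Poisson twisting system of $A$ (defined in the context). Then the Poisson twist $A^\delta$ is (isomorphic as a Poisson algebra to) a TGWPA. (3) Let $\phi$ be a diagonal Poisson automorphism of $A$ (defined in the context). Then the invariant ring $A^{\langle\phi\rangle}$ is (isomorphic as a Poisson algebra to) a TGWPA.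
   Context: All algebras are over a field $\Bbbk$. A Poisson algebra is a commutative algebra $R$ with a Lie bracket $\{,\}$ such that each $\{r,-\}$ is a derivation. A derivation $\partial$ of $R$ is a Poisson derivation if $\partial(\{r,s\})=\{\partial(r),s\}+\{r,\partial(s)\}$ for all $r,s$. An element $a$ is Poisson central if $\{a,-\}=0$. Write $[n]=\{1,\dots,n\}$. TGWPA of type $(A_1)^n$ (of rank $n$): Fix an integer $n\ge 1$. Let $R$ be a Poisson algebra, $\boldsymbol\partial=(\partial_1,\dots,\partial_n)$ an $n$-tuple of pairwise commuting Poisson derivations of $R$, and $\mathbf a=(a_1,\dots,a_n)$ an $n$-tuple of Poisson central regular (non-zero-divisor) elements of $R$. Assume there are scalars $\mu_{ij},\gamma_{ij}\in\Bbbk$ ($i\ne j$) with $\partial_j(a_i)=\gamma_{ij}a_i$ and $\gamma_{ij}+\gamma_{ji}=\mu_{ij}+\mu_{ji}$ for all $i\neq j$. Then $A_\mu(R,\boldsymbol\partial,\mathbf a)$ is the algebra $R[x_1,y_1,\dots,x_n,y_n]/(y_1x_1-a_1,\dots,y_nx_n-a_n)$ with Poisson bracket extending that of $R$ and given by $\{r,x_i\}=\partial_i(r)x_i$, $\{r,y_i\}=-\partial_i(r)y_i$, $\{y_i,x_i\}=\partial_i(a_i)$ for $i\in[n]$, $r\in R$, and $\{y_i,x_j\}=\mu_{ij}x_jy_i$, $\{x_i,x_j\}=(\gamma_{ij}-\mu_{ij})x_ix_j$, $\{y_i,y_j\}=(\mu_{ji}-\gamma_{ij})y_iy_j$ for $i\ne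 j$ in $[n]$. It is a $\mathbb Z^n$-graded Poisson algebra with $\deg x_i=\mathbf e_i$, $\deg y_i=-\mathbf e_i$, $\deg r=\mathbf 0$ for $r\in R$, where $\mathbf e_i$ are the standard basis vectors. Tensor products: for Poisson algebras $B,C$, the tensor product $B\otimes C$ carries the Poisson bracket $\{b_1\otimes c_1,b_2\otimes c_2\}=\{b_1,b_2\}\otimes c_1c_2+b_1b_2\otimes\{c_1,c_2\}$. Poisson twists: let $G$ be an abelian group and $A$ a $G$-graded Poisson algebra. A set $\delta=\{\delta_g\mid g\in G\}$ of graded (degree-preserving) Poisson derivations of $A$ is a Poisson twisting system if $\delta_g\delta_h=\delta_h\delta_g$ for all $g,h\in G$ and $\delta_{|ab|}=\delta_{|a|}+\delta_{|b|}$ for all homogeneous $a,b\in A$, where $|a|=\deg a$. The Poisson twist $A^\delta$ is the algebra $A$ with the new Poisson bracket $\langle a,b\rangle=\{a,b\}+a\delta_{|a|}(b)-b\delta_{|b|}(a)$ for homogeneous $a,b$. For a TGWPA $A$ of rank $n$ with its $\mathbb Z^n$-grading, a diagonal Poisson twisting system is a Poisson twisting system $\delta=\{\delta_{\boldsymbol\alpha}\mid\boldsymbol\alpha\in\mathbb Z^n\}$ of the form $\delta_{\boldsymbol\alpha}=\sum_{i=1}^n\alpha_i\delta_{\mathbf e_i}$, where there are $q_{kj},p_{kj}\in\Bbbk^\times$ such that for all $k,j\in[n]$: $\delta_{\mathbf e_k}(x_j)=q_{kj}x_j$, $\delta_{\mathbf e_k}(y_j)=p_{kj}y_j$, $\delta_{\mathbf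 e_k}(a_j)=(q_{kj}+p_{kj})a_j$, and $\partial_j\delta_{\mathbf e_k}=\delta_{\mathbf e_k}\partial_j$ on $R$. Diagonal automorphisms: a diagonal Poisson automorphism of a TGWPA $A=A_\mu(R,\boldsymbol\partial,\mathbf a)$ of rank $n$ is a Poisson algebra automorphism $\phi$ of $A$ such that (i) $\phi|_R$ is an automorphism of $R$ of finite order $\ell$; (ii) for each $i\in[n]$, $\phi(x_i)=\alpha_ix_i$ and $\phi(y_i)=\alpha_i^{-1}y_i$ for some $\alpha_i\in\Bbbk^\times$ of finite multiplicative order $m_i$; (iii) the integers $\ell,m_1,\dots,m_n$ are pairwise relatively prime. $A^{\langle\phi\rangle}$ is the Poisson subalgebra of elements fixed by $\phi$. *)

(* Defs.v *)
From HB Require Import structures.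
From mathcomp Require Import all_boot all_order all_algebra.
From mathcomp Require Import ring_quotient.
From mathcomp Require Import boolp.
From mathcomp Require Import mpoly.

Set Implicit Arguments.
Unset Strict Implicit.
Unset Printing Implicit Defensive.

Import GRing.Theory.
Local Open Scope ring_scope.

Section PoissonAlgebras.
Variable k : fieldType.

Definition is_bilinear (U V W : lmodType k) (f : U -> V -> W) : Prop :=
  (forall v, linear (f^~ v)) /\ (forall u, linear (f u)).

Definition is_derivation (R : comAlgType k) (d : R -> R) : Prop :=
  linear d /\ forall r s, d (r * s) = d r * s + r * d s.

Record is_poisson_bracket (R : comAlgType k) (br : R -> R -> R) : Prop := {
  pbr_bilinear : is_bilinear br;
  pbr_alternating : forall r, br r r = 0;
  pbr_jacobi : forall r s t,
    br r (br s t) + br s (br t r) + br t (br r s) = 0;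
  pbr_derivation : forall r, is_derivation (br r)
}.

End PoissonAlgebras.

Record poissonAlg (k : fieldType) := PoissonAlg {
  palg :> comAlgType k;
  pbr : palg -> palg -> palg;
  pbrP : is_poisson_bracket pbr
}.
Arguments PoissonAlg {k palg pbr} pbrP.
Arguments pbr {k p} r s : rename.

Section PoissonNotions.
Variable k : fieldType.

Definition is_poisson_derivation (R : poissonAlg k) (d : R -> R) : Prop :=
  is_derivation d /\ forall r s, d (pbr r s) = pbr (d r) s + pbr r (d s).

Definition poisson_central (R : poissonAlg k) (a : R) : Prop :=
  forall r, pbr a r = 0.

Definition regular (R : comAlgType k) (a : R) : Prop :=
  forall r, a * r = 0 -> r = 0.

Definition is_poisson_iso (A B : poissonAlg k) (f : {lrmorphism A -> B}) : Prop :=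
  bijective f /\ forall a b, f (pbr a b) = pbr (f a) (f b).

Definition poisson_isomorphic (A B : poissonAlg k) : Prop :=
  exists f : {lrmorphism A -> B}, is_poisson_iso f.

End PoissonNotions.

(* prod_xy i is a_i, the value of y_i x_i.  mu and gamma are only ever used at
   i != j, so their diagonal values are irrelevant. *)
Record tgwpa_data (k : fieldType) (n : nat) := TgwpaData {
  rank_gt0 : (0 < n)%N;
  base : poissonAlg k;
  pder : 'I_n -> base -> base;
  prod_xy : 'I_n -> base;
  mu : 'I_n -> 'I_n -> k;
  gamma : 'I_n -> 'I_n -> k;
  pderP : forall i, is_poisson_derivation (pder i);
  pder_comm : forall i j r, pder i (pder j r) = pder j (pder i r);
  prod_xy_central : forall i, poisson_central (prod_xy i);
  prod_xy_regular : forall i, regular (prod_xy i);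
  pder_prod_xy : forall i j, i != j ->
    pder j (prod_xy i) = gamma i j *: prod_xy i;
  gammaD_mu : forall i j, i != j -> gamma i j + gamma j i = mu i j + mu j i
}.

Section TgwpaAlgebra.
Variables (k : fieldType) (n : nat) (D : tgwpa_data k n).
Local Notation R := (base D).
Local Notation P := {mpoly R[n + n]}.

(* The variables of R[x_1, y_1, ..., x_n, y_n]: the first n of the n + n
   indeterminates are the x_i, the last n are the y_i. *)
Definition varx (i : 'I_n) : P := 'X_(lshift n i).
Definition vary (i : 'I_n) : P := 'X_(rshift n i).

Definition tgwpa_ideal : {pred P} := fun p =>
  asbool (exists q : 'I_n -> P,
    p = \sum_i q i * (vary i * varx i - (prod_xy D i)%:MP)).

Let ev (p : P) : R :=
  mmap idfun
    (fun j => match split j with inl _ => 1 | inr i => prod_xy D i end) p.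

Lemma tgwpa_idealr_closed : idealr_closed tgwpa_ideal.
Proof.
split.
- by apply/asboolP; exists (fun=> 0); rewrite big1 // => i _; rewrite mul0r.
- apply/negP => /asboolP[q].
  move/(congr1 ev); rewrite /ev rmorph1 rmorph_sum big1 /= => [/eqP|i _].
    by rewrite oner_eq0.
  rewrite rmorphM rmorphB rmorphM /= !mmapX mmapC !mmap1U /=.
  rewrite -[lshift n i]/(unsplit (inl i)) -[rshift n i]/(unsplit (inr i)).
  by rewrite !unsplitK mulr1 subrr mulr0.
- move=> a u v /asboolP[q ->] /asboolP[q' ->]; apply/asboolP.
  exists (fun i => a * q i + q' i).
  rewrite mulr_sumr -big_split; apply: eq_bigr => i _.
  by rewrite mulrDl mulrA.
Qed.

HB.instance Definition _ := isIdealr.Build P tgwpa_ideal tgwpa_idealr_closed.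

Definition tgwpa_quot : Type := {ideal_quot tgwpa_ideal}.
HB.instance Definition _ := GRing.ComNzRing.on tgwpa_quot.

Definition tgwpa_pi (p : P) : tgwpa_quot := \pi_({ideal_quot tgwpa_ideal})%qT p.

Fact tgwpa_pi_is_zmod_morphism : zmod_morphism tgwpa_pi.
Proof. exact: (rmorphB (\pi_({ideal_quot tgwpa_ideal})%qT)). Qed.
Fact tgwpa_pi_is_monoid_morphism : monoid_morphism tgwpa_pi.
Proof.
by split; [exact: (rmorph1 (\pi_({ideal_quot tgwpa_ideal})%qT))
          | exact: (rmorphM (\pi_({ideal_quot tgwpa_ideal})%qT))].
Qed.
HB.instance Definition _ :=
  GRing.isZmodMorphism.Build P tgwpa_quot tgwpa_pi tgwpa_pi_is_zmod_morphism.
HB.instance Definition _ :=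
  GRing.isMonoidMorphism.Build P tgwpa_quot tgwpa_pi tgwpa_pi_is_monoid_morphism.

(* P is only an R-algebra for the library, so the k-algebra structure of the
   quotient is the one given by the ring morphism k -> R -> P -> P / I. *)
Definition tgwpa_scale (c : k) (u : tgwpa_quot) : tgwpa_quot :=
  tgwpa_pi ((c%:A : R)%:MP) * u.

Fact tgwpa_scaleA a b u :
  tgwpa_scale a (tgwpa_scale b u) = tgwpa_scale (a * b) u.
Proof.
rewrite /tgwpa_scale mulrA -rmorphM -mpolyCM; congr (tgwpa_pi _%:MP * _).
by rewrite mulr_algl scalerA.
Qed.
Fact tgwpa_scale1 : left_id 1 tgwpa_scale.
Proof. by move=> u; rewrite /tgwpa_scale scale1r rmorph1 mul1r. Qed.
Fact tgwpa_scaleDr : right_distributive tgwpa_scale +%R.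
Proof. by move=> a u v; rewrite /tgwpa_scale mulrDr. Qed.
Fact tgwpa_scaleDl u : {morph tgwpa_scale^~ u : a b / a + b}.
Proof. by move=> a b; rewrite /tgwpa_scale scalerDl !rmorphD mulrDl. Qed.
HB.instance Definition _ := GRing.Zmodule_isLmodule.Build k tgwpa_quot
  tgwpa_scaleA tgwpa_scale1 tgwpa_scaleDr tgwpa_scaleDl.

Fact tgwpa_scaleAl (a : k) (u v : tgwpa_quot) : a *: (u * v) = a *: u * v.
Proof. exact: mulrA. Qed.
HB.instance Definition _ :=
  GRing.Lmodule_isLalgebra.Build k tgwpa_quot tgwpa_scaleAl.
HB.instance Definition _ := GRing.Lalgebra_isComAlgebra.Build k tgwpa_quot.

Definition tgwpa_alg : comAlgType k := tgwpa_quot.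

Definition tgwpa_const (r : R) : tgwpa_alg := tgwpa_pi r%:MP.
Definition tgwpa_x (i : 'I_n) : tgwpa_alg := tgwpa_pi (varx i).
Definition tgwpa_y (i : 'I_n) : tgwpa_alg := tgwpa_pi (vary i).

Record is_tgwpa_bracket (br : tgwpa_alg -> tgwpa_alg -> tgwpa_alg) : Prop := {
  tbr_const : forall r s,
    br (tgwpa_const r) (tgwpa_const s) = tgwpa_const (pbr r s);
  tbr_const_x : forall r i,
    br (tgwpa_const r) (tgwpa_x i) = tgwpa_const (pder i r) * tgwpa_x i;
  tbr_const_y : forall r i,
    br (tgwpa_const r) (tgwpa_y i) = - (tgwpa_const (pder i r) * tgwpa_y i);
  tbr_yx : forall i,
    br (tgwpa_y i) (tgwpa_x i) = tgwpa_const (pder i (prod_xy D i));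
  tbr_yx_neq : forall i j, i != j ->
    br (tgwpa_y i) (tgwpa_x j) = mu D i j *: (tgwpa_x j * tgwpa_y i);
  tbr_xx_neq : forall i j, i != j ->
    br (tgwpa_x i) (tgwpa_x j) =
      (gamma D i j - mu D i j) *: (tgwpa_x i * tgwpa_x j);
  tbr_yy_neq : forall i j, i != j ->
    br (tgwpa_y i) (tgwpa_y j) =
      (mu D j i - gamma D i j) *: (tgwpa_y i * tgwpa_y j)
}.

(* The Z^n-grading: component alpha is spanned over R by the monomials
   x^u y^v with u - v = alpha. *)
Definition tgwpa_homog (alpha : 'rV[int]_n) (a : tgwpa_alg) : Prop :=
  exists2 p : P, a = tgwpa_pi p &
    forall m, m \in msupp p -> forall i,
      (m (lshift n i))%:Z - (m (rshift n i))%:Z = alpha 0 i.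

End TgwpaAlgebra.

(* The Poisson algebra A_mu(R, pder, a).  Its bracket is determined by the
   data, since the algebra is generated by R and the x_i, y_i. *)
Record tgwpa (k : fieldType) (n : nat) (D : tgwpa_data k n) := Tgwpa {
  tgwpa_br : tgwpa_alg D -> tgwpa_alg D -> tgwpa_alg D;
  tgwpa_br_poisson : is_poisson_bracket tgwpa_br;
  tgwpa_brP : is_tgwpa_bracket tgwpa_br
}.

Definition tgwpa_poisson (k : fieldType) (n : nat) (D : tgwpa_data k n)
  (A : tgwpa D) : poissonAlg k := PoissonAlg (tgwpa_br_poisson A).
Coercion tgwpa_poisson : tgwpa >-> poissonAlg.

Definition isomorphic_to_tgwpa (k : fieldType) (B : poissonAlg k) : Prop :=
  exists (n : nat) (D : tgwpa_data k n) (A : tgwpa D), poisson_isomorphic B A.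

Section TensorProduct.
Variable k : fieldType.

(* The universal property, with tens b c playing the role of b (x) c. *)
Record is_tensor_product (B C T : lmodType k) (tens : B -> C -> T) : Prop := {
  tens_bilinear : is_bilinear tens;
  tens_lift : forall (V : lmodType k) (f : B -> C -> V), is_bilinear f ->
    exists g : {linear T -> V}, forall b c, g (tens b c) = f b c;
  tens_ext : forall (V : lmodType k) (g h : {linear T -> V}),
    (forall b c, g (tens b c) = h (tens b c)) -> g =1 h
}.

Record is_poisson_tensor_product (B C T : poissonAlg k)
    (tens : B -> C -> T) : Prop := {
  ptens_tensor : is_tensor_product tens;
  ptens_1 : tens 1 1 = 1;
  ptens_mul : forall b1 b2 c1 c2,
    tens b1 c1 * tens b2 c2 = tens (b1 * b2) (c1 * c2);
  ptens_br : forall b1 b2 c1 c2,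
    pbr (tens b1 c1) (tens b2 c2) =
      tens (pbr b1 b2) (c1 * c2) + tens (b1 * b2) (pbr c1 c2)
}.

End TensorProduct.

Section PoissonTwist.
Variables (k : fieldType) (G : zmodType) (A : poissonAlg k).
Variable Agr : G -> A -> Prop.

(* The degree of ab only makes sense when ab != 0. *)
Record is_poisson_twisting_system (delta : G -> A -> A) : Prop := {
  twist_derivation : forall g, is_poisson_derivation (delta g);
  twist_graded : forall g h a, Agr h a -> Agr h (delta g a);
  twist_comm : forall g h a, delta g (delta h a) = delta h (delta g a);
  twist_add : forall g h a b, Agr g a -> Agr h b -> a * b != 0 ->
    forall c, delta (g + h) c = delta g c + delta h c
}.

Definition is_twisted_bracket (delta : G -> A -> A) (tw : A -> A -> A) : Prop :=
  is_bilinear tw /\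
  forall g h a b, Agr g a -> Agr h b ->
    tw a b = pbr a b + a * delta g b - b * delta h a.

End PoissonTwist.

Section DiagonalTwist.
Variables (k : fieldType) (n : nat) (D : tgwpa_data k n) (A : tgwpa D).

Let e (i : 'I_n) : 'rV[int]_n := delta_mx 0 i.

Record is_diagonal_twisting_system (delta : 'rV[int]_n -> A -> A) : Prop := {
  dtwist_system : is_poisson_twisting_system (A := A) (@tgwpa_homog k n D) delta;
  dtwist_sum : forall alpha a,
    delta alpha a = \sum_i delta (e i) a *~ alpha 0 i;
  dtwist_diag : exists q p : 'I_n -> 'I_n -> k, forall l j,
    [/\ q l j != 0 /\ p l j != 0,
        delta (e l) (tgwpa_x D j) = q l j *: tgwpa_x D j,
        delta (e l) (tgwpa_y D j) = p l j *: tgwpa_y D j &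
        delta (e l) (tgwpa_const (prod_xy D j)) =
          (q l j + p l j) *: tgwpa_const (prod_xy D j)];
  (* delta (e l) preserves the degree 0 component R of A; r |-> s below is its
     restriction to R. *)
  dtwist_pder : forall l j (r s : base D),
    delta (e l) (tgwpa_const r) = tgwpa_const s ->
    delta (e l) (tgwpa_const (pder j r)) = tgwpa_const (pder j s)
}.

End DiagonalTwist.

Record poissonAut (k : fieldType) (A : poissonAlg k) := PoissonAut {
  paut :> {lrmorphism A -> A};
  pautP : is_poisson_iso paut
}.

Section Invariants.
Variables (k : fieldType) (A : poissonAlg k) (phi : poissonAut A).

Definition fixed : {pred A} := fun a => phi a == a.

Fact fixed_subalg_closed : subalg_closed fixed.
Proof.
split=> [|c u v|u v]; rewrite /fixed !unfold_in.
- by rewrite rmorph1.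
- by move=> /eqP hu /eqP hv; rewrite linearD linearZ /= hu hv.
- by move=> /eqP hu /eqP hv; rewrite rmorphM /= hu hv.
Qed.
HB.instance Definition _ := GRing.isSubalgClosed.Build k A fixed
  fixed_subalg_closed.

Record inv_type : Type := InvType { inv_val : A; _ : inv_val \in fixed }.
HB.instance Definition _ := [isSub for inv_val].
HB.instance Definition _ := [Choice of inv_type by <:].
HB.instance Definition _ := [SubChoice_isSubComNzRing of inv_type by <:].
HB.instance Definition _ := [SubNmodule_isSubLSemiModule of inv_type by <:].
HB.instance Definition _ := [SubNzRing_SubLmodule_isSubLalgebra of inv_type by <:].
HB.instance Definition _ := [SubLalgebra_isSubAlgebra of inv_type by <:].

Fact fixed_pbr (u v : inv_type) : pbr (\val u) (\val v) \in fixed.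
Proof.
case: u v => [u /eqP hu] [v /eqP hv] /=.
by rewrite unfold_in /fixed (pautP phi).2 hu hv.
Qed.

Definition inv_br (u v : inv_type) : inv_type := InvType (fixed_pbr u v).

Fact inv_br_poisson : is_poisson_bracket inv_br.
Proof.
have [[bl br] alt jac der] := pbrP A.
split.
- by split=> [v c u u'|u c v v']; apply: val_inj; rewrite /= (bl, br).
- by move=> u; apply: val_inj; apply: alt.
- by move=> u v w; apply: val_inj; apply: jac.
- move=> u; split=> [c v w|v w]; apply: val_inj; first exact: br.
  exact: (der _).2.
Qed.

Definition invariants : poissonAlg k := PoissonAlg inv_br_poisson.

End Invariants.

Section DiagonalAutomorphism.
Variables (k : fieldType) (n : nat) (D : tgwpa_data k n) (A : tgwpa D).

Definition has_order (X : Type) (f : X -> X) (l : nat) : Prop :=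
  [/\ (0 < l)%N, iter l f =1 id &
      forall j, (0 < j < l)%N -> ~ (iter j f =1 id)].

(* l.-primitive_root z says that z has multiplicative order exactly l > 0. *)
Definition is_diagonal_automorphism (phi : poissonAut A) : Prop :=
  exists (sigma : poissonAut (base D)) (l : nat)
         (alpha : 'I_n -> k) (m : 'I_n -> nat),
  [/\ (forall r, phi (tgwpa_const r) = tgwpa_const (sigma r)) /\
        has_order sigma l,
      forall i, [/\ alpha i != 0, (m i).-primitive_root (alpha i),
        phi (tgwpa_x D i) = alpha i *: tgwpa_x D i &
        phi (tgwpa_y D i) = (alpha i)^-1 *: tgwpa_y D i],
      forall i, coprime l (m i) &
      forall i j, i != j -> coprime (m i) (m j)].

End DiagonalAutomorphism.

(* Main.v *)
(* An element of a TGWPA has a unique normal form: a polynomial over R in which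
   no x_i occurs together with y_i, obtained by replacing y_i x_i by a_i.  Hence
   the coefficient of a reduced monomial is a well-defined k-linear map A -> R.
   A TGWPA presentation of a Poisson algebra B is therefore obtained from a base
   and elements x_i, y_i of B satisfying the relations, as soon as the reduced
   monomials in them form a basis of B over the base; the bracket is then
   transported from B.

   (1) The base is the image of R (x) R' in T, with the x_i (x) 1, 1 (x) x'_j and
   y_i (x) 1, 1 (x) y'_j as generators.  That a_i (x) 1 stays regular is flatness
   over a field: multiplication by a_i has a k-linear left inverse, given by
   Zorn's lemma.

   (2) With E_i the Euler derivation of the i-th component of the grading, the
   twisted bracket is {,} + sum_i E_i /\ delta_{e_i}, a deformation of {,} by
   pairwise commuting Poisson derivations.  The new data are
   der_i - delta_{e_i}, mu_ij - q_ij - p_ji and gamma_ij - q_ji - p_ji.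

   (3) A^phi is generated over R^phi by the x_i^{m_i} and y_i^{m_i}; the new data
   are m_i der_i, a_i^{m_i}, m_i m_j mu_ij and m_i m_j gamma_ij. *)

Require Import Defs.
From HB Require Import structures.
From mathcomp Require Import all_boot all_order all_algebra.
From mathcomp Require Import ring_quotient boolp ssrcomplements mpoly ring zify.
From mathcomp Require classical_sets.

Set Implicit Arguments.
Unset Strict Implicit.
Unset Printing Implicit Defensive.

Import GRing.Theory.
Local Open Scope ring_scope.

(** * Linear relations and Poisson brackets *)

Section LinearRelations.
Variables (k : fieldType) (U V : lmodType k).

(** The graph of a partial linear map from U to V: a subspace of U x V whose only element above 0 is
    0. Partial maps are ordered by inclusion of their graphs. *)
Definition linear_relation (G : U * V -> Prop) : Prop :=
  [/\ G (0, 0),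
      forall c u v u' v', G (u, v) -> G (u', v') -> G (c *: u + u', c *: v + v')
    & forall v, G (0, v) -> v = 0].

Lemma linear_relation_fun (G : U * V -> Prop) u v v' :
  linear_relation G -> G (u, v) -> G (u, v') -> v = v'.
Proof.
move=> [_ GL G0] Gv Gv'; apply/eqP; rewrite -subr_eq0; apply/eqP/G0.
by have := GL (-1) _ _ _ _ Gv' Gv; rewrite !scaleN1r addNr addrC.
Qed.

(** Extends a partial map by sending [w], outside its domain, to [v0]. The result is still
    single-valued: u + c w = 0 with c nonzero and u in the domain would put [w] into the domain. *)
Lemma linear_relation_adjoin (G : U * V -> Prop) w v0 :
  linear_relation G -> (forall v, ~ G (w, v)) ->
  linear_relation
    (fun z => exists c u, z.1 = u + c *: w /\ G (u, z.2 - c *: v0)).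
Proof.
move=> [G0 GL GF] Nw; split=> [|c _ v _ v' /= [d [u [-> Gu]]] [d' [u' [-> Gu']]]|v].
- by exists 0, 0; rewrite !scale0r subr0 addr0.
- exists (c * d + d'), (c *: u + u'); split.
    by rewrite scalerDr scalerDl scalerA addrACA.
  have -> : c *: v + v' - (c * d + d') *: v0 = c *: (v - d *: v0) + (v' - d' *: v0).
    by rewrite scalerBr scalerDl opprD scalerA addrACA.
  exact: GL.
- move=> /= [c [u [/esym/eqP]]]; rewrite addr_eq0 => /eqP -> Gv.
  have [c0|cN0] := eqVneq c 0.
    by move: Gv; rewrite c0 !scale0r oppr0 subr0 => /GF.
  case: (Nw (- c^-1 *: (v - c *: v0))).
  have := GL (- c^-1) _ _ _ _ Gv G0.
  by rewrite !addr0 scalerN scaleNr opprK scalerA mulVf // scale1r.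
Qed.

Lemma linear_relation_extend (G0 : U * V -> Prop) :
  linear_relation G0 ->
  exists2 g : U -> V, linear g & forall u v, G0 (u, v) -> g u = v.
Proof.
move=> G0L.
pose ext G := linear_relation G /\ forall z, G0 z -> G z.
have [|G [Gext Gmax]] :=
    (* The guard makes the empty set admissible, as it is the union of the empty chain. *)
    @classical_sets.Zorn_bigcup _ (fun G => (exists z, G z) -> ext G).
  move=> F FP Ftot [z [X FX Xz]].
  have [[X0 XL XF] G0X] := FP _ FX (ex_intro _ z Xz).
  have Fext Y y : F Y -> Y y -> ext Y by move=> FY Yy; apply: FP => //; exists y.
  split=> [|y G0y]; last by exists X => //; exact: G0X.
  split=> [|c u v u' v' [Y FY Yu] [Y' FY' Yu']|v [Y FY Yv]].
  - by exists X.
  - case: (Ftot _ _ FY FY') => sub; [exists Y' | exists Y] => //.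
      by have [[_ YL _] _] := Fext _ _ FY' Yu'; apply: YL => //; exact: sub.
    by have [[_ YL _] _] := Fext _ _ FY Yu; apply: YL => //; exact: sub.
  - by have [[_ _ YF] _] := Fext _ _ FY Yv; exact: YF.
have [GL G0G] : ext G.
  (* A maximal element cannot be empty, since [G0] would properly contain it. *)
  apply: Gext; apply: contrapT => Gempty; apply: (Gmax G0) => //.
  split=> [z Gz|sub]; case: Gempty; first by exists z.
  by exists (0, 0); apply: sub; case: G0L.
have Gtot u : exists v, G (u, v).
  apply: contrapT => Nu.
  have {}Nu v : ~ G (u, v) by move=> Gv; apply: Nu; exists v.
  have [G00 _ _] := GL.
  (* Any value at [u] would do; adjoining it with value 0 contradicts maximality. *)
  apply: (Gmax (fun z => exists c w, z.1 = w + c *: u /\ G (w, z.2 - c *: 0))).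
    split=> [[w v] Gz|sub]; first by exists 0, w; rewrite !scale0r subr0 addr0.
    by apply: (Nu 0); apply: sub; exists 1, 0; rewrite !scale1r subr0 add0r.
  move=> _; split; first exact: linear_relation_adjoin.
  by move=> [w v] /G0G Gz; exists 0, w; rewrite !scale0r subr0 addr0.
have [g Gg] := choice Gtot.
exists g => [c u v|u v /G0G Gz]; last exact: linear_relation_fun GL (Gg u) Gz.
by case: (GL) => _ GC _; apply: linear_relation_fun GL (Gg _) _; exact: GC.
Qed.

(** The graph of [f] read backwards is a partial linear map on the image, single-valued because the
    kernel is zero; an extension of it to all of U is a left inverse. *)
Lemma linear_left_inverse (f : V -> U) :
  linear f -> (forall v, f v = 0 -> v = 0) ->
  exists2 g : U -> V, linear g & cancel f g.
Proof.
move=> fL f0.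
have f00 : f 0 = 0.
  by have := fL (-1) 0 0; rewrite scaleN1r oppr0 addr0 scaleN1r addNr.
have [|g gL gf] := @linear_relation_extend (fun z => f z.2 = z.1); last first.
  by exists g => // v; exact: gf.
split=> //= c u v u' v' <- <-; exact: fL.
Qed.

End LinearRelations.

(** * Calculus of derivations and of Poisson brackets *)

Section Derivations.
Variable k : fieldType.

Section Theory.
Variables (R : comAlgType k) (d : R -> R).
Hypothesis dP : is_derivation d.

Lemma derivationD r s : d (r + s) = d r + d s.
Proof. by have := dP.1 1 r s; rewrite !scale1r. Qed.

Lemma derivation0 : d 0 = 0.
Proof. by apply: (addrI (d 0)); rewrite -derivationD !addr0. Qed.

Lemma derivationZ c r : d (c *: r) = c *: d r.
Proof. by have := dP.1 c r 0; rewrite !addr0 derivation0 addr0. Qed.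

Lemma derivationN r : d (- r) = - d r.
Proof. by rewrite -!scaleN1r derivationZ. Qed.

Lemma derivationB r s : d (r - s) = d r - d s.
Proof. by rewrite derivationD derivationN. Qed.

Lemma derivationM r s : d (r * s) = d r * s + r * d s.
Proof. exact: dP.2. Qed.

Lemma derivation1 : d 1 = 0.
Proof.
by apply: (addrI (d 1)); have := derivationM 1 1; rewrite !mulr1 mul1r addr0.
Qed.

Lemma derivationXn r n : d (r ^+ n) = n%:R * r ^+ n.-1 * d r.
Proof.
elim: n => [|n IH]; first by rewrite expr0 derivation1 !mul0r.
rewrite exprS derivationM IH; case: n {IH} => [|n] /=; first by rewrite !expr0 /=; ring.
by rewrite -[n.+2]addn1 natrD exprS; ring.
Qed.

(** If r has logarithmic derivative w, then r^n has logarithmic derivative n w; no predecessor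
    exponent appears in this form, which is what makes brackets of powers easy to compute. *)
Lemma derivation_eigenXn (w r : R) n : d r = w * r -> d (r ^+ n) = n%:R * w * r ^+ n.
Proof.
move=> dr; rewrite derivationXn dr; case: n => [|n]; first by rewrite !mul0r.
by rewrite exprS; ring.
Qed.

End Theory.

Lemma is_derivationD (R : comAlgType k) (d e : R -> R) :
  is_derivation d -> is_derivation e -> is_derivation (fun r => d r + e r).
Proof.
move=> dP eP; split=> [c r s|r s].
  by rewrite (dP.1 c) (eP.1 c) scalerDr addrACA.
by rewrite (derivationM dP) (derivationM eP); ring.
Qed.

Lemma is_derivationZ (R : comAlgType k) c (d : R -> R) :
  is_derivation d -> is_derivation (fun r => c *: d r).
Proof.
move=> dP; split=> [b r s|r s].
  by rewrite (dP.1 b) scalerDr !scalerA mulrC.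
by rewrite (derivationM dP) scalerDr scalerAl scalerAr.
Qed.

End Derivations.

Section PoissonBracketTheory.
Variables (k : fieldType) (R : comAlgType k) (br : R -> R -> R).
Hypothesis brP : is_poisson_bracket br.

Lemma pbr_antisym r s : br r s = - br s r.
Proof.
have [[brL brR] alt _ der] := brP.
have hL u : br (r + s) u = br r u + br s u.
  by have /= := brL u 1 r s; rewrite !scale1r.
have := alt (r + s); rewrite (derivationD (der _)) !hL !alt add0r addr0 addrC.
by move/eqP; rewrite addr_eq0 => /eqP.
Qed.

Lemma pbr_derivation_l s : is_derivation (br^~ s).
Proof.
have [_ _ _ der] := brP.
have -> : br^~ s = fun r => (-1 : k) *: br s r.
  by apply/funext => r; rewrite scaleN1r pbr_antisym.
exact: is_derivationZ.
Qed.

Lemma pbr_jacobi_derivation r s t : br r (br s t) = br (br r s) t + br s (br r t).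
Proof.
have [_ _ jac der] := brP.
apply/eqP; rewrite -subr_eq0 -(jac r s t); apply/eqP.
rewrite (pbr_antisym t (br r s)) (pbr_antisym t r) (derivationN (der s)).
by ring.
Qed.

End PoissonBracketTheory.


Section PoissonDerivations.
Variables (k : fieldType) (R : poissonAlg k).
Let brP := pbrP R.
Let der := pbr_derivation brP.
Let derl := pbr_derivation_l brP.

Lemma is_poisson_derivationB (d e : R -> R) :
  is_poisson_derivation d -> is_poisson_derivation e ->
  is_poisson_derivation (fun r => d r - e r).
Proof.
move=> [dP dbr] [eP ebr]; split.
  have := is_derivationD dP (is_derivationZ (-1) eP).
  by congr is_derivation; apply/funext => r; rewrite scaleN1r.
move=> r s; rewrite dbr ebr (derivationB (derl _)) (derivationB (der _)).
by ring.
Qed.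

Lemma is_poisson_derivationZ c (d : R -> R) :
  is_poisson_derivation d -> is_poisson_derivation (fun r => c *: d r).
Proof.
move=> [dP dbr]; split; first exact: is_derivationZ.
by move=> r s; rewrite dbr scalerDr (derivationZ (derl _)) (derivationZ (der _)).
Qed.

End PoissonDerivations.

(** * Deformation of a Poisson bracket by commuting Poisson derivations *)

Section Wedge.
Variables (k : fieldType) (R : comAlgType k).

Definition wedge_bracket (br : R -> R -> R) (E d : R -> R) (r s : R) : R :=
  br r s + (E r * d s - E s * d r).

(** Poisson derivations of a bare bracket, so that several brackets can be considered on one
    algebra. *)
Definition bracket_derivation (br : R -> R -> R) (d : R -> R) : Prop :=
  is_derivation d /\ forall r s, d (br r s) = br (d r) s + br r (d s).

Lemma wedge_bracket_derivation br E d e :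
  bracket_derivation br e -> is_derivation E -> is_derivation d ->
  (forall r, e (E r) = E (e r)) -> (forall r, e (d r) = d (e r)) ->
  bracket_derivation (wedge_bracket br E d) e.
Proof.
move=> [eP ebr] EP dP eE ed; split=> // r s; rewrite /wedge_bracket.
rewrite (derivationD eP) (derivationB eP) !(derivationM eP) ebr !eE !ed.
by ring.
Qed.

(** The Jacobiator of the sum has a part from [br] alone, a mixed part and a part from E /\ d alone.
    The first is 0, the mixed one vanishes because [E] and [d] are derivations of [br], the last
    because they commute. *)
Lemma wedge_bracketP br E d :
  is_poisson_bracket br -> bracket_derivation br E -> bracket_derivation br d ->
  (forall r, E (d r) = d (E r)) -> is_poisson_bracket (wedge_bracket br E d).
Proof.
move=> brP [EP Ebr] [dP dbr] Ed.
have der := pbr_derivation brP; have derl := pbr_derivation_l brP.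
have wder r : is_derivation (wedge_bracket br E d r).
  split=> [c s t|s t]; rewrite /wedge_bracket.
    rewrite (der r).1 dP.1 EP.1 !mulrDr !mulrDl -!scalerAr -!scalerAl.
    rewrite !scalerDr scalerN; ring.
  rewrite (derivationM (der r)) (derivationM dP) (derivationM EP); ring.
have walt r : wedge_bracket br E d r r = 0.
  by rewrite /wedge_bracket (pbr_alternating brP) subrr addr0.
split=> //.
- split=> [s c r t|r]; last exact: (wder r).1.
  rewrite /wedge_bracket (derl s).1 dP.1 EP.1 !mulrDr !mulrDl -!scalerAr -!scalerAl.
  rewrite !scalerDr scalerN; ring.
- move=> r s t; rewrite /wedge_bracket.
  rewrite !(derivationD (der _), derivationN (der _), derivationM (der _)).
  rewrite !(derivationD EP, derivationN EP, derivationM EP).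
  rewrite !(derivationD dP, derivationN dP, derivationM dP) !Ebr !dbr !Ed.
  (* Jacobi eliminates one double bracket and antisymmetry orients the remaining brackets, so that
     [ring] can treat them as independent atoms. *)
  rewrite (pbr_jacobi_derivation brP r s t).
  rewrite (pbr_antisym brP t r) (pbr_antisym brP t (br r s)) (derivationN (der s)).
  rewrite ?(pbr_antisym brP t s) ?(pbr_antisym brP s r).
  rewrite !(pbr_antisym brP _ (E _)) !(pbr_antisym brP _ (d _)).
  ring.
Qed.


Variables (I : Type) (br : R -> R -> R) (E d : I -> R -> R).
Hypothesis brP : is_poisson_bracket br.
Hypothesis EP : forall i, bracket_derivation br (E i).
Hypothesis dP : forall i, bracket_derivation br (d i).
Hypothesis EC : forall i j r, E i (E j r) = E j (E i r).
Hypothesis dC : forall i j r, d i (d j r) = d j (d i r).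
Hypothesis EdC : forall i j r, E i (d j r) = d j (E i r).

Definition wedge_sum_bracket (s : seq I) (a b : R) : R :=
  br a b + \sum_(i <- s) (E i a * d i b - E i b * d i a).

Lemma wedge_sum_bracket_cons i s :
  wedge_sum_bracket (i :: s) = wedge_bracket (wedge_sum_bracket s) (E i) (d i).
Proof.
apply/funext => a; apply/funext => b.
by rewrite /wedge_sum_bracket /wedge_bracket big_cons addrCA addrC.
Qed.

Lemma wedge_sum_bracket_nil : wedge_sum_bracket [::] = br.
Proof.
by apply/funext => a; apply/funext => b; rewrite /wedge_sum_bracket big_nil addr0.
Qed.

(** A derivation commuting with every [E i] and [d i] survives each single deformation. Hence all
    [E i] and [d i] remain Poisson derivations of every partial sum, and [wedge_bracketP] can be
    iterated. *)
Lemma wedge_sum_bracket_derivation s e :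
  bracket_derivation br e -> (forall i r, e (E i r) = E i (e r)) ->
  (forall i r, e (d i r) = d i (e r)) ->
  bracket_derivation (wedge_sum_bracket s) e.
Proof.
move=> eP eE ed; elim: s => [|i s IH]; first by rewrite wedge_sum_bracket_nil.
rewrite wedge_sum_bracket_cons.
by apply: wedge_bracket_derivation => //; [exact: (EP i).1 | exact: (dP i).1].
Qed.

Lemma wedge_sum_bracketP s : is_poisson_bracket (wedge_sum_bracket s).
Proof.
elim: s => [|i s IH]; first by rewrite wedge_sum_bracket_nil.
rewrite wedge_sum_bracket_cons.
by apply: wedge_bracketP => //; apply: wedge_sum_bracket_derivation.
Qed.

End Wedge.

(** * Normal forms *)

Section PairedGenerators.
Variables (n : nat) (S : Type) (u v : 'I_n -> S).

Definition paired_gens (j : 'I_(n + n)) : S :=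
  match split j with inl i => u i | inr i => v i end.

Lemma paired_gensX i : paired_gens (lshift n i) = u i.
Proof. by rewrite /paired_gens -[lshift n i]/(unsplit (inl i)) unsplitK. Qed.

Lemma paired_gensY i : paired_gens (rshift n i) = v i.
Proof. by rewrite /paired_gens -[rshift n i]/(unsplit (inr i)) unsplitK. Qed.

End PairedGenerators.

Lemma mmap1_paired_gens n (S : comNzRingType) (u v : 'I_n -> S) M :
  mmap1 (paired_gens u v) M =
  \prod_i (u i ^+ M (lshift n i) * v i ^+ M (rshift n i)).
Proof.
rewrite /mmap1 big_split_ord big_split /=; congr (_ * _).
  by apply: eq_bigr => i _; rewrite paired_gensX.
by apply: eq_bigr => i _; rewrite paired_gensY.
Qed.

Section MonomialExtension.
Variables (N : nat) (R : comNzRingType) (M : lmodType R) (F : 'X_{1..N} -> M).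

Definition mlin (p : {mpoly R[N]}) : M := \sum_(m <- msupp p) p@_m *: F m.

(** A degree bound replaces the support of [p] by an index set common to several polynomials, so
    that linearity can be checked termwise. *)
Lemma mlinwE p w : (msize p <= w)%N ->
  mlin p = \sum_(m : 'X_{1..N < w}) p@_m *: F m.
Proof.
move=> le_pw; pose I : subFinType _ := 'X_{1..N < w}.
rewrite /mlin (big_mksub I) ?msupp_uniq //=; last first.
  by move=> m /msize_mdeg_lt /leq_trans; apply.
by rewrite big_rmcond //= => m /memN_msupp_eq0 ->; rewrite scale0r.
Qed.

Lemma mlin_linear : linear mlin.
Proof.
move=> c p q; pose w := maxn (msize (c *: p + q)) (maxn (msize p) (msize q)).
rewrite !(@mlinwE _ w) ?leq_max ?leqnn ?orbT // scaler_sumr -big_split /=.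
by apply: eq_bigr => m _; rewrite mcoeffD mcoeffZ scalerDl scalerA.
Qed.

HB.instance Definition _ := GRing.isLinear.Build R {mpoly R[N]} M _ mlin mlin_linear.

Lemma mlinX m : mlin 'X_[m] = F m.
Proof. by rewrite /mlin msuppX big_seq1 mcoeffX eqxx scale1r. Qed.

End MonomialExtension.

Section TgwpaTheory.
Variables (k : fieldType) (n : nat) (D : tgwpa_data k n).
Local Notation R := (base D).
Local Notation P := {mpoly R[n + n]}.
Local Notation A := (tgwpa_alg D).
Local Notation X := (lshift n).
Local Notation Y := (@rshift n n).
Local Notation pi := (@tgwpa_pi k n D).
Local Notation Id := (@tgwpa_ideal k n D).
Local Notation const := (@tgwpa_const k n D).

Lemma tgwpa_pi_surj (a : A) : exists p, a = pi p.
Proof. by exists (repr (a : {ideal_quot Id})); rewrite /tgwpa_pi reprK. Qed.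

Lemma tgwpa_pi_eq0 p : (pi p = 0) <-> (p \in Id).
Proof.
rewrite -[p in X in _ <-> X]subr0 Quotient.idealrBE.
by rewrite -(rmorph0 pi); split=> /eqP.
Qed.


Lemma tgwpa_constZ c r : const (c *: r) = c *: const r.
Proof.
by rewrite /tgwpa_const -mulr_algl mpolyCM rmorphM.
Qed.

Fact tgwpa_const_zmod_morphism : zmod_morphism const.
Proof. by move=> r s; rewrite /tgwpa_const !rmorphB. Qed.
Fact tgwpa_const_monoid_morphism : monoid_morphism const.
Proof.
by split=> [|r s]; rewrite /tgwpa_const ?mpolyC1 ?rmorph1 // mpolyCM rmorphM.
Qed.
HB.instance Definition _ :=
  GRing.isZmodMorphism.Build R A const tgwpa_const_zmod_morphism.
HB.instance Definition _ :=
  GRing.isMonoidMorphism.Build R A const tgwpa_const_monoid_morphism.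
HB.instance Definition _ :=
  GRing.isScalable.Build k R A *:%R const tgwpa_constZ.

Definition tgwpa_monomial (m : 'X_{1..n + n}) : A := pi 'X_[m].
Local Notation mon := tgwpa_monomial.

Lemma tgwpa_piZ c p : pi (c *: p) = const c * pi p.
Proof. by rewrite -mul_mpolyC rmorphM. Qed.

Lemma tgwpa_piE p : pi p = \sum_(m <- msupp p) const p@_m * mon m.
Proof.
by rewrite {1}[p]mpolyE raddf_sum; apply: eq_bigr => m _ /=; rewrite tgwpa_piZ.
Qed.

Lemma tgwpa_monomialE m :
  mon m = \prod_i (tgwpa_x D i ^+ m (X i) * tgwpa_y D i ^+ m (Y i)).
Proof.
rewrite /tgwpa_monomial mpolyXE_id rmorph_prod big_split_ord big_split /=.
by congr (_ * _); apply: eq_bigr => i _; rewrite rmorphXn.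
Qed.

Lemma tgwpa_xy i : tgwpa_y D i * tgwpa_x D i = const (prod_xy D i).
Proof.
apply/eqP; rewrite -subr_eq0 -rmorphM -rmorphB; apply/eqP/tgwpa_pi_eq0/asboolP.
exists (fun j => (j == i)%:R); rewrite (bigD1 i) //= eqxx mul1r big1 ?addr0 //.
by move=> j /negPf ->; rewrite mul0r.
Qed.

Lemma tgwpa_ind (Q : A -> Prop) :
  (forall r, Q (const r)) -> (forall i, Q (tgwpa_x D i)) ->
  (forall i, Q (tgwpa_y D i)) ->
  (forall a b, Q a -> Q b -> Q (a + b)) ->
  (forall a b, Q a -> Q b -> Q (a * b)) ->
  forall a, Q a.
Proof.
move=> Qc Qx Qy QD QM a; have [p ->] := tgwpa_pi_surj a.
have Q1 : Q 1 by rewrite -(rmorph1 const); exact: Qc.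
have QX u j : Q u -> Q (u ^+ j).
  by move=> Qu; elim: j => [|j IH]; rewrite ?expr0 // exprS; exact: QM.
rewrite tgwpa_piE; apply: big_rec => [|m b _ Qb].
  by rewrite -(rmorph0 const); exact: Qc.
apply: (QD) => //; apply: (QM) => //; rewrite tgwpa_monomialE.
apply: big_rec => [//|i c _ Qc']; apply: (QM) => //.
by apply: (QM); apply: (QX).
Qed.

Lemma tgwpa_derivation_ext (d e : A -> A) :
  is_derivation d -> is_derivation e ->
  (forall r, d (const r) = e (const r)) ->
  (forall i, d (tgwpa_x D i) = e (tgwpa_x D i)) ->
  (forall i, d (tgwpa_y D i) = e (tgwpa_y D i)) -> d =1 e.
Proof.
move=> dP eP hc hx hy; apply: tgwpa_ind => // a b da db.
  by rewrite (derivationD dP) (derivationD eP) da db.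
by rewrite (derivationM dP) (derivationM eP) da db.
Qed.

(* Subtraction of naturals is truncated, so at most one of the exponents of x_i
   and y_i survives. *)
Definition mred (m : 'X_{1..n + n}) : 'X_{1..n + n} :=
  [multinom (m j - m (match split j with inl i => Y i | inr i => X i end))%N
     | j < n + n].

Definition reduced (m : 'X_{1..n + n}) : Prop :=
  forall i, m (X i) = 0%N \/ m (Y i) = 0%N.

(** The coefficient produced by reduction: each pair y_i x_i contained in the monomial is replaced
    by a_i, and there are as many pairs as the smaller exponent. *)
Definition mcancel (m : 'X_{1..n + n}) : R :=
  \prod_i prod_xy D i ^+ minn (m (X i)) (m (Y i)).

Definition nf : P -> P := mlin (fun m => mcancel m *: 'X_[mred m]).
HB.instance Definition _ := GRing.Linear.on nf.

Lemma mredX m i : mred m (X i) = (m (X i) - m (Y i))%N.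
Proof. by rewrite mnmE -[X i]/(unsplit (inl i)) unsplitK. Qed.

Lemma mredY m i : mred m (Y i) = (m (Y i) - m (X i))%N.
Proof. by rewrite mnmE -[Y i]/(unsplit (inr i)) unsplitK. Qed.

Lemma multinomP (m m' : 'X_{1..n + n}) :
  (forall i, m (X i) = m' (X i)) -> (forall i, m (Y i) = m' (Y i)) -> m = m'.
Proof.
move=> hX hY; apply/mnmP => j; rewrite -[j]splitK.
by case: (split j) => i /=.
Qed.

Lemma mred_reduced m : reduced (mred m).
Proof. by move=> i; rewrite mredX mredY; lia. Qed.

Lemma reduced_mred m : reduced m -> mred m = m.
Proof.
by move=> mP; apply: multinomP => i; rewrite (mredX, mredY); case: (mP i); lia.
Qed.

Lemma reduced_mcancel m : reduced m -> mcancel m = 1.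
Proof.
by move=> mP; apply: big1 => i _; case: (mP i) => ->; rewrite ?min0n ?minn0.
Qed.

Lemma nfX m : nf 'X_[m] = mcancel m *: 'X_[mred m].
Proof. exact: mlinX. Qed.

(** By linearity the multiplier of y_i x_i - a_i may be taken to be a monomial m. Multiplying m by
    y_i x_i leaves its reduced monomial unchanged and multiplies its coefficient by a_i, so the two
    terms cancel. *)
Lemma nf_ideal p : p \in Id -> nf p = 0.
Proof.
move=> /asboolP[q ->]; rewrite raddf_sum big1 // => i _.
elim/mpolyind: (q i) => [|c m q' _ _ IH]; first by rewrite mul0r raddf0.
rewrite mulrDl raddfD IH addr0 /= -scalerAl linearZ mulrBr.
rewrite -!mpolyXD [_ * _%:MP]mulrC mul_mpolyC raddfB /= linearZ /= !nfX.
set m' := (m + _)%MM.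
have m'X j : m' (X j) = (m (X j) + (i == j))%N.
  by rewrite /m' !mnmDE !mnm1E eq_rlshift eq_lshift addnA addn0.
have m'Y j : m' (Y j) = (m (Y j) + (i == j))%N.
  by rewrite /m' !mnmDE !mnm1E eq_lrshift eq_rshift addn0.
have -> : mred m' = mred m.
  by apply: multinomP => j; rewrite !(mredX, mredY) m'X m'Y subnDr.
have -> : mcancel m' = prod_xy D i * mcancel m.
  rewrite /mcancel (bigD1 i) // [in RHS](bigD1 i) //= mulrA -exprS.
  rewrite m'X m'Y eqxx !addn1 minnSS; congr (_ * _); apply: eq_bigr => j ij.
  by rewrite m'X m'Y eq_sym (negPf ij) !addn0.
by rewrite scalerA subrr scaler0.
Qed.

Lemma tgwpa_monomial_red m : mon m = const (mcancel m) * mon (mred m).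
Proof.
rewrite !tgwpa_monomialE rmorph_prod -big_split; apply: eq_bigr => i _ /=.
rewrite mredX mredY rmorphXn /= -tgwpa_xy exprMn.
have [le|/ltnW le] := leqP (m (X i)) (m (Y i)).
  move: (le); rewrite -subn_eq0 => /eqP ->.
  rewrite -{1}(subnKC le) exprD; ring.
move: (le); rewrite -subn_eq0 => /eqP ->.
rewrite -{1}(subnKC le) exprD; ring.
Qed.

Lemma tgwpa_pi_nf p : pi (nf p) = pi p.
Proof.
rewrite [in RHS]tgwpa_piE /nf /mlin raddf_sum; apply: eq_bigr => m _ /=.
by rewrite !tgwpa_piZ [in RHS]tgwpa_monomial_red.
Qed.

Lemma nf_reduced p m : m \in msupp (nf p) -> reduced m.
Proof.
move=> mp; apply: contrapT => Nm; move: mp; rewrite mcoeff_msupp => /eqP; apply.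
rewrite raddf_sum big1 // => m' _ /=; rewrite !mcoeffZ mcoeffX.
by case: eqP => [E|_]; [case: Nm; rewrite -E; exact: mred_reduced | rewrite !mulr0].
Qed.

(** Existence and uniqueness of normal forms: [nf] does not change the class, and it kills the
    ideal. *)
Lemma nf_pi p q : (pi p = pi q) <-> (nf p = nf q).
Proof.
split=> [E|E]; last by rewrite -tgwpa_pi_nf E tgwpa_pi_nf.
apply/eqP; rewrite -subr_eq0 -raddfB; apply/eqP/nf_ideal/tgwpa_pi_eq0.
by rewrite raddfB /= E subrr.
Qed.

(** The normal form of a chosen representative; [tgwpa_nf_pi] shows that the choice is
    immaterial. *)
Definition tgwpa_nf (a : A) : P := nf (projT1 (cid (tgwpa_pi_surj a))).

Lemma tgwpa_nf_pi p : tgwpa_nf (pi p) = nf p.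
Proof. by rewrite /tgwpa_nf; case: cid => q /= /nf_pi. Qed.

Lemma tgwpa_nfK : cancel tgwpa_nf pi.
Proof. by move=> a; rewrite /tgwpa_nf; case: cid => p /= ->; exact: tgwpa_pi_nf. Qed.

Lemma tgwpa_nf_reduced a m : m \in msupp (tgwpa_nf a) -> reduced m.
Proof. exact: nf_reduced. Qed.

Lemma tgwpa_nfD a b : tgwpa_nf (a + b) = tgwpa_nf a + tgwpa_nf b.
Proof.
by rewrite -[a]tgwpa_nfK -[b]tgwpa_nfK -raddfD /= !tgwpa_nf_pi raddfD.
Qed.

Lemma tgwpa_nf_constM r a : tgwpa_nf (const r * a) = r *: tgwpa_nf a.
Proof.
by rewrite -[a]tgwpa_nfK -tgwpa_piZ !tgwpa_nf_pi linearZ.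
Qed.

Lemma tgwpa_nfZ c a : tgwpa_nf (c *: a) = (c%:A : R) *: tgwpa_nf a.
Proof. exact: tgwpa_nf_constM. Qed.

Lemma tgwpa_nf_monomial m : reduced m -> tgwpa_nf (mon m) = 'X_[m].
Proof.
by move=> mP; rewrite tgwpa_nf_pi nfX reduced_mcancel // scale1r reduced_mred.
Qed.

Lemma tgwpa_nf_const r : tgwpa_nf (const r) = r%:MP.
Proof.
have m1 : mon 0 = 1 by rewrite /tgwpa_monomial mpolyX0 rmorph1.
rewrite -[const r]mulr1 tgwpa_nf_constM -m1 tgwpa_nf_monomial.
  by rewrite mpolyX0 alg_mpolyC.
by left; rewrite mnm0E.
Qed.

Lemma tgwpa_const_inj : injective const.
Proof.
move=> r s /(congr1 tgwpa_nf); rewrite !tgwpa_nf_const => /(congr1 (mcoeff 0)).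
by rewrite !mcoeffC eqxx !mulr1.
Qed.

(** * Universal property of the algebra underlying a TGWPA *)

Section Lift.
Variables (B : comAlgType k) (f : {lrmorphism R -> B}) (u v : 'I_n -> B).
Hypothesis vuP : forall i, v i * u i = f (prod_xy D i).

(** Substituting [u] and [v] for the variables kills each y_i x_i - a_i by [vuP], so it factors
    through the quotient. The last clause keeps the substitution formula, with which images of
    normal forms are computed. *)
Lemma tgwpa_lift : exists g : {lrmorphism A -> B},
  [/\ forall r, g (const r) = f r, forall i, g (tgwpa_x D i) = u i,
      forall i, g (tgwpa_y D i) = v i
    & forall p, g (pi p) = mmap f (paired_gens u v) p].
Proof.
pose h := paired_gens u v.
pose g a := mmap f h (projT1 (cid (tgwpa_pi_surj a))).
have gE p : g (pi p) = mmap f h p.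
  rewrite /g; case: cid => q /= E; apply/eqP; rewrite -subr_eq0 -raddfB.
  have /asboolP[s ->] : q - p \in Id.
    by apply/tgwpa_pi_eq0; rewrite raddfB /= -E subrr.
  rewrite raddf_sum big1 // => i _ /=.
  rewrite rmorphM rmorphB rmorphM /= !mmapX !mmap1U mmapC.
  by rewrite /h paired_gensX paired_gensY vuP subrr mulr0.
have gB : zmod_morphism g.
  move=> a b; have [[p ->] [q ->]] := (tgwpa_pi_surj a, tgwpa_pi_surj b).
  by rewrite -raddfB !gE raddfB.
have gM : monoid_morphism g.
  split=> [|a b]; first by rewrite -(rmorph1 pi) gE rmorph1.
  have [[p ->] [q ->]] := (tgwpa_pi_surj a, tgwpa_pi_surj b).
  by rewrite -rmorphM !gE rmorphM.
have gZ : scalable g.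
  move=> c a; have [p ->] := tgwpa_pi_surj a.
  rewrite -[c *: pi p]/(const _ * pi p) -tgwpa_piZ !gE mmapZ.
  have fc : f c%:A = c *: 1 by rewrite linearZ rmorph1.
  by rewrite [X in X * _]fc mulr_algl.
pose G : {lrmorphism A -> B} := HB.pack g
  (GRing.isZmodMorphism.Build _ _ _ gB) (GRing.isMonoidMorphism.Build _ _ _ gM)
  (GRing.isScalable.Build _ _ _ _ _ gZ).
exists G; split=> [r|i|i|//].
- by rewrite [LHS]gE mmapC.
- by rewrite [LHS]gE mmapX mmap1U /h paired_gensX.
- by rewrite [LHS]gE mmapX mmap1U /h paired_gensY.
Qed.

End Lift.

End TgwpaTheory.

(** * Transport of the bracket and the grading *)

Section Transport.
Variables (k : fieldType) (n : nat) (D : tgwpa_data k n) (B : poissonAlg k).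
Variable f : {lrmorphism tgwpa_alg D -> B}.
Local Notation const := (@tgwpa_const k n D).
Local Notation x := (tgwpa_x D).
Local Notation y := (tgwpa_y D).

(** The bracket of [B] is pulled back along the algebra isomorphism [f]. The Poisson axioms are
    inherited, and what remains are the defining relations on generators, checked inside [B]. *)
Lemma isomorphic_to_tgwpa_transport :
  bijective f ->
  (forall r s, pbr (f (const r)) (f (const s)) = f (const (pbr r s))) ->
  (forall r i, pbr (f (const r)) (f (x i)) = f (const (pder i r)) * f (x i)) ->
  (forall r i, pbr (f (const r)) (f (y i)) = - (f (const (pder i r)) * f (y i))) ->
  (forall i, pbr (f (y i)) (f (x i)) = f (const (pder i (prod_xy D i)))) ->
  (forall i j, i != j ->
     [/\ pbr (f (y i)) (f (x j)) = mu D i j *: (f (x j) * f (y i)),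
         pbr (f (x i)) (f (x j)) =
           (gamma D i j - mu D i j) *: (f (x i) * f (x j))
       & pbr (f (y i)) (f (y j)) =
           (mu D j i - gamma D i j) *: (f (y i) * f (y j))]) ->
  isomorphic_to_tgwpa B.
Proof.
move=> [g fK gK] hrs hrx hry hyx hneq.
have [[brL brR] alt jac der] := pbrP B.
have gB : zmod_morphism g.
  by move=> u v; apply: (can_inj fK); rewrite rmorphB /= !gK.
have gM : monoid_morphism g.
  by split=> [|u v]; apply: (can_inj fK); rewrite ?rmorph1 ?rmorphM /= ?gK.
have gZ : scalable g.
  by move=> c u; apply: (can_inj fK); rewrite linearZ /= !gK.
pose G : {lrmorphism B -> tgwpa_alg D} := HB.pack g
  (GRing.isZmodMorphism.Build _ _ _ gB) (GRing.isMonoidMorphism.Build _ _ _ gM)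
  (GRing.isScalable.Build _ _ _ _ _ gZ).
have gL c u v : g (c *: u + v) = c *: g u + g v by exact: (linearP G).
have gD u v : g (u + v) = g u + g v by exact: (rmorphD G).
have g0 : g 0 = 0 by exact: (rmorph0 G).
pose br u v := g (pbr (f u) (f v)).
have brP : is_poisson_bracket br.
  split=> [|u|u v w|u]; rewrite /br.
  - by split=> [v c u u'|u c v v'] /=; rewrite linearP /= -gL (brL, brR).
  - by rewrite alt.
  - by rewrite !gK -!gD jac.
  - split=> [c v w|v w]; first by rewrite linearP /= -gL brR.
    by rewrite rmorphM /= (derivationM (der _)) gD !gM.2 !fK.
have brT : is_tgwpa_bracket br.
  split=> [r s|r i|r i|i|i j ij|i j ij|i j ij]; apply: (can_inj fK);
    rewrite gK ?linearN ?linearZ /= ?rmorphM //; by case: (hneq i j ij).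
exists n, D, (Tgwpa brP brT), G; split; first by exists f.
by move=> u v; rewrite /= /br !gK.
Qed.

End Transport.

Section DerivationCommutators.
Variables (k : fieldType) (R : comAlgType k).

Lemma is_derivation0 : is_derivation (fun _ : R => 0).
Proof. by split=> [c r s|r s]; rewrite /= ?scaler0 ?mulr0 ?mul0r addr0. Qed.

Lemma is_derivation_commutator (d e : R -> R) :
  is_derivation d -> is_derivation e -> is_derivation (fun r => d (e r) - e (d r)).
Proof.
move=> dP eP; split=> [c r s|r s].
  by rewrite eP.1 dP.1 dP.1 eP.1 opprD addrACA -scalerBr.
rewrite (derivationM eP) (derivationM dP) (derivationD eP) (derivationD dP).
rewrite !(derivationM eP) !(derivationM dP).
ring.
Qed.

End DerivationCommutators.

(** * The grading by Z^n and its Euler derivations *)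

Section Grading.
Variables (k : fieldType) (n : nat) (D : tgwpa_data k n).
Local Notation R := (base D).
Local Notation P := {mpoly R[n + n]}.
Local Notation A := (tgwpa_alg D).
Local Notation X := (lshift n).
Local Notation Y := (@rshift n n).
Local Notation pi := (@tgwpa_pi k n D).
Local Notation Id := (@tgwpa_ideal k n D).
Local Notation const := (@tgwpa_const k n D).
Local Notation x := (tgwpa_x D).
Local Notation y := (tgwpa_y D).

(** The Euler derivation x_i d/dx_i - y_i d/dy_i, which multiplies a monomial by the i-th component
    of its degree. *)
Definition euler_poly (i : 'I_n) (p : P) : P :=
  'X_(X i) * p^`M(X i) - 'X_(Y i) * p^`M(Y i).

Lemma euler_polyD i p q : euler_poly i (p + q) = euler_poly i p + euler_poly i q.
Proof. by rewrite /euler_poly !mderivD; ring. Qed.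

Lemma euler_polyB i p q : euler_poly i (p - q) = euler_poly i p - euler_poly i q.
Proof. by rewrite /euler_poly !mderivB; ring. Qed.

Lemma euler_polyM i p q :
  euler_poly i (p * q) = euler_poly i p * q + p * euler_poly i q.
Proof. by rewrite /euler_poly !mderivM; ring. Qed.

Lemma euler_polyC i r : euler_poly i r%:MP = 0.
Proof. by rewrite /euler_poly !mderivC !mulr0 subrr. Qed.

Lemma mpolyX_mderiv (j : 'I_(n + n)) m :
  'X_j * ('X_[m])^`M(j) = 'X_[m] *+ m j :> P.
Proof.
rewrite mderivX -scalerAr -mpolyXD scaler_nat.
case: (posnP (m j)) => [->|m0]; first by rewrite !mulr0n.
by rewrite addmC submK // lep1mP -lt0n.
Qed.

Lemma euler_polyX i m :
  euler_poly i 'X_[m] = 'X_[m] *~ ((m (X i))%:Z - (m (Y i))%:Z).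
Proof. by rewrite /euler_poly !mpolyX_mderiv mulrzBr. Qed.

(** Each y_j x_j - a_j has degree 0, hence is killed; only the multipliers get differentiated. *)
Lemma euler_poly_ideal i p : p \in Id -> euler_poly i p \in Id.
Proof.
move=> /asboolP[q ->]; apply/asboolP; exists (fun j => euler_poly i (q j)).
rewrite (big_morph _ (euler_polyD i) (euler_polyC i 0)); apply: eq_bigr => j _.
rewrite euler_polyM euler_polyB euler_polyC subr0 -mpolyXD euler_polyX.
rewrite !mnmDE !mnm1E eq_rlshift eq_lshift eq_lrshift eq_rshift.
by rewrite add0n addn0 subrr mulr0 addr0.
Qed.

Definition euler (i : 'I_n) (a : A) : A := pi (euler_poly i (tgwpa_nf a)).

Lemma euler_pi i p : euler i (pi p) = pi (euler_poly i p).
Proof.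
apply/eqP; rewrite -subr_eq0 -rmorphB -euler_polyB.
apply/eqP/tgwpa_pi_eq0/euler_poly_ideal/tgwpa_pi_eq0.
by rewrite rmorphB /= tgwpa_nfK subrr.
Qed.

Lemma euler_const i r : euler i (const r) = 0.
Proof. by rewrite euler_pi euler_polyC rmorph0. Qed.

Lemma euler_derivation i : is_derivation (euler i).
Proof.
have eM (a b : A) : euler i (a * b) = euler i a * b + a * euler i b.
  have [[p ->] [q ->]] := (tgwpa_pi_surj a, tgwpa_pi_surj b).
  by rewrite -rmorphM !euler_pi euler_polyM rmorphD !rmorphM.
split=> // c a b.
have eD (u v : A) : euler i (u + v) = euler i u + euler i v.
  have [[p ->] [q ->]] := (tgwpa_pi_surj u, tgwpa_pi_surj v).
  by rewrite -rmorphD !euler_pi euler_polyD rmorphD.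
by rewrite eD -[c *: a]/(const c%:A * a) eM euler_const mul0r add0r.
Qed.

Lemma euler_homog i alpha a : tgwpa_homog alpha a -> euler i a = a *~ alpha 0 i.
Proof.
move=> [p -> pP]; rewrite euler_pi -rmorphMz; congr pi.
rewrite [p in RHS]mpolyE [p in LHS]mpolyE.
rewrite (big_morph _ (euler_polyD i) (euler_polyC i 0)) mulrz_suml.
apply: eq_big_seq => m mp.
rewrite -mul_mpolyC euler_polyM euler_polyC mul0r add0r euler_polyX (pP _ mp).
by rewrite mulrzAr.
Qed.

Lemma tgwpa_const_homog r : tgwpa_homog 0 (const r).
Proof.
exists r%:MP => // m; rewrite msuppC; case: ifP => // _.
by rewrite inE => /eqP -> i; rewrite !mnm0E mxE.
Qed.

Lemma tgwpa_x_homog i : tgwpa_homog (delta_mx 0 i) (x i).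
Proof.
exists 'X_(X i) => // m; rewrite msuppX inE => /eqP -> j.
by rewrite !mnm1E eq_lshift eq_lrshift mxE eqxx /= subr0 eq_sym; case: eqP.
Qed.

Lemma tgwpa_y_homog i : tgwpa_homog (- delta_mx 0 i) (y i).
Proof.
exists 'X_(Y i) => // m; rewrite msuppX inE => /eqP -> j.
by rewrite !mnm1E eq_rshift eq_rlshift !mxE eqxx /= sub0r eq_sym; case: eqP.
Qed.

(** A monomial of degree 0 has equal exponents of x_i and y_i for every i, so it reduces to a
    product of powers of the a_i. *)
Lemma tgwpa_homog0 a : tgwpa_homog 0 a -> exists r, a = const r.
Proof.
move=> [p -> pP]; exists (\sum_(m <- msupp p) p@_m * mcancel D m).
rewrite tgwpa_piE raddf_sum; apply: eq_big_seq => m /pP mP.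
have m0 : mred m = 0%MM.
  have mE i : m (X i) = m (Y i).
    by apply/eqP; rewrite -eqz_nat -subr_eq0 mP mxE.
  by apply: multinomP => i; rewrite ?mredX ?mredY mE subnn mnm0E.
rewrite tgwpa_monomial_red m0 /= [RHS]rmorphM /=.
by rewrite /tgwpa_monomial mpolyX0 rmorph1 mulr1.
Qed.

Lemma tgwpa_homog_ind (Q : A -> Prop) :
  (forall alpha a, tgwpa_homog alpha a -> Q a) ->
  (forall a b, Q a -> Q b -> Q (a + b)) -> forall a, Q a.
Proof.
move=> Qh QD a; have [p ->] := tgwpa_pi_surj a.
elim/mpolyind: p => [|c m p _ _ IH].
  by rewrite rmorph0 -(rmorph0 const); apply: (Qh); exact: tgwpa_const_homog.
rewrite rmorphD; apply: (QD) => //.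
apply: (Qh (\row_i ((m (X i))%:Z - (m (Y i))%:Z))); exists (c *: 'X_[m]) => //.
move=> m' /msuppZ_le; rewrite msuppX inE => /eqP -> i.
by rewrite mxE.
Qed.

(** For fixed a, the map sending b to d{a,b} - {a,d b} is a commutator of derivations, so it equals
    {d a,-} as soon as both agree on generators. The condition is symmetric in a and b, so the same
    argument then reduces a to generators. *)
Lemma bracket_derivation_gen (br : A -> A -> A) (d : A -> A) :
  is_poisson_bracket br -> is_derivation d ->
  let Q a b := d (br a b) = br (d a) b + br a (d b) in
  (forall r s, Q (const r) (const s)) ->
  (forall r i, Q (const r) (x i)) -> (forall r i, Q (const r) (y i)) ->
  (forall i j, Q (x i) (x j)) -> (forall i j, Q (y i) (x j)) ->
  (forall i j, Q (y i) (y j)) -> bracket_derivation br d.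
Proof.
move=> brP dP Q Qcc Qcx Qcy Qxx Qyx Qyy; split=> //.
have der := pbr_derivation brP; have derl := pbr_derivation_l brP.
have Qsym a b : Q a b -> Q b a.
  rewrite /Q (pbr_antisym brP b a) (pbr_antisym brP (d b)) (pbr_antisym brP b).
  by rewrite (derivationN dP) => ->; rewrite opprD addrC.
suff Qg a : (forall r, Q a (const r)) -> (forall i, Q a (x i)) ->
    (forall i, Q a (y i)) -> forall b, Q a b.
  have Qc r b : Q (const r) b by apply: Qg.
  have Qx i b : Q (x i) b by apply: Qg => // *; apply: Qsym.
  have Qy i b : Q (y i) b by apply: Qg => // *; apply: Qsym.
  by move=> a b; apply: Qg => *; apply: Qsym.
move=> hc hx hy b.
suff : d (br a b) - br a (d b) = br (d a) b by move/eqP; rewrite subr_eq => /eqP.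
apply: (@tgwpa_derivation_ext _ _ _ (fun b => d (br a b) - br a (d b))) => //.
- exact: is_derivation_commutator.
- by move=> r; rewrite hc addrK.
- by move=> i; rewrite hx addrK.
- by move=> i; rewrite hy addrK.
Qed.

Lemma derivations_commute_gen (d e : A -> A) :
  is_derivation d -> is_derivation e ->
  (forall r, d (e (const r)) = e (d (const r))) ->
  (forall i, d (e (x i)) = e (d (x i))) ->
  (forall i, d (e (y i)) = e (d (y i))) -> forall a, d (e a) = e (d a).
Proof.
move=> dP eP hc hx hy a; apply/eqP; rewrite -subr_eq0; apply/eqP.
apply: (@tgwpa_derivation_ext _ _ _ (fun a => d (e a) - e (d a)) (fun=> 0)).
- exact: is_derivation_commutator.
- exact: is_derivation0.
- by move=> r; rewrite hc subrr.
- by move=> i; rewrite hx subrr.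
- by move=> i; rewrite hy subrr.
Qed.

End Grading.

(** * Poisson twists *)

Section Twist.
Variables (k : fieldType) (n : nat) (D : tgwpa_data k n) (A : tgwpa D).
Local Notation R := (base D).
Local Notation T := (tgwpa_alg D).
Local Notation const := (@tgwpa_const k n D).
Local Notation x := (tgwpa_x D).
Local Notation y := (tgwpa_y D).
Local Notation br := (tgwpa_br A).

Let brP := tgwpa_br_poisson A.
Let brT := tgwpa_brP A.
Let der := pbr_derivation brP.
Let derl := pbr_derivation_l brP.

Lemma euler_x i j : euler i (x j) = ((i == j)%:R : k) *: x j.
Proof.
by rewrite (euler_homog _ (tgwpa_x_homog D j)) mxE eqxx -scaler_int; case: (i == j).
Qed.

Lemma euler_y i j : euler i (y j) = (- (i == j)%:R : k) *: y j.
Proof.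
rewrite (euler_homog _ (tgwpa_y_homog D j)) !mxE eqxx -scaler_int.
by case: (i == j); rewrite /= mulrNz.
Qed.

(** The bracket adds degrees on generators, and the Euler derivation multiplies a homogeneous
    element by a component of its degree. *)
Lemma euler_bracket_derivation i : bracket_derivation br (euler i).
Proof.
have EP := euler_derivation D i.
apply: bracket_derivation_gen => //.
- move=> r s; rewrite (tbr_const brT) !euler_const (derivation0 (der _)).
  by rewrite (derivation0 (derl _)) addr0.
- move=> r j; rewrite (tbr_const_x brT) (derivationM EP) !euler_const euler_x.
  rewrite (derivation0 (derl _)) (derivationZ (der _)) (tbr_const_x brT).
  by rewrite scalerAr; ring.
- move=> r j; rewrite (tbr_const_y brT) (derivationN EP) (derivationM EP).
  rewrite !euler_const euler_y (derivation0 (derl _)) (derivationZ (der _)).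
  by rewrite (tbr_const_y brT) scalerN -scalerAr; ring.
- move=> j l; rewrite !euler_x (derivationZ (derl _)) (derivationZ (der _)).
  have [->|jl] := eqVneq j l.
    by rewrite (pbr_alternating brP) (derivation0 EP) !scaler0 addr0.
  rewrite (tbr_xx_neq brT jl) (derivationZ EP) (derivationM EP) !euler_x.
  rewrite -!scalerAl -!scalerAr scalerDr !scalerA.
  by congr (_ *: _ + _ *: _); ring.
- move=> j l; rewrite euler_x euler_y (derivationZ (derl _)) (derivationZ (der _)).
  have [->|jl] := eqVneq j l.
    by rewrite (tbr_yx brT) euler_const -scalerDl addNr scale0r.
  rewrite (tbr_yx_neq brT jl) (derivationZ EP) (derivationM EP) euler_x euler_y.
  rewrite -!scalerAl -!scalerAr [RHS]addrC scalerDr !scalerA.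
  by congr (_ *: _ + _ *: _); ring.
- move=> j l; rewrite !euler_y (derivationZ (derl _)) (derivationZ (der _)).
  have [->|jl] := eqVneq j l.
    by rewrite (pbr_alternating brP) (derivation0 EP) !scaler0 addr0.
  rewrite (tbr_yy_neq brT jl) (derivationZ EP) (derivationM EP) !euler_y.
  rewrite -!scalerAl -!scalerAr scalerDr !scalerA.
  by congr (_ *: _ + _ *: _); ring.
Qed.

Variable delta : 'rV[int]_n -> T -> T.
Hypothesis deltaP : is_diagonal_twisting_system (A := A) delta.
Let dl (l : 'I_n) : T -> T := delta (delta_mx 0 l).

Variables q p : 'I_n -> 'I_n -> k.
Hypothesis dlx : forall l j, dl l (x j) = q l j *: x j.
Hypothesis dly : forall l j, dl l (y j) = p l j *: y j.
Hypothesis dla : forall l j,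
  dl l (const (prod_xy D j)) = (q l j + p l j) *: const (prod_xy D j).

Let sysP := dtwist_system deltaP.

Let dlP l : bracket_derivation br (dl l).
Proof. exact: (twist_derivation sysP). Qed.

(** [dl l] preserves degrees, and the component of degree 0 is the image of the base; this is what
    allows restricting it to the base. *)
Lemma twist_const l r : exists s, dl l (const r) = const s.
Proof. exact/tgwpa_homog0/(twist_graded sysP)/tgwpa_const_homog. Qed.

Definition twist_base l r : R := projT1 (cid (twist_const l r)).

Lemma twist_baseE l r : const (twist_base l r) = dl l (const r).
Proof. by rewrite /twist_base; case: cid. Qed.

Lemma twist_base_poisson l : is_poisson_derivation (twist_base l).
Proof.
have dD := (dlP l).1.
split; [split=> [c r s|r s]|move=> r s]; apply: tgwpa_const_inj.
- by rewrite linearP /= !twist_baseE -dD.1 linearP.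
- by rewrite rmorphD !rmorphM /= !twist_baseE -(derivationM dD) rmorphM.
- rewrite rmorphD /= -!(tbr_const brT) !twist_baseE.
  by rewrite -(dlP l).2 (tbr_const brT).
Qed.

Lemma twist_base_prod_xy l j :
  twist_base l (prod_xy D j) = (q l j + p l j) *: prod_xy D j.
Proof. by apply: tgwpa_const_inj; rewrite twist_baseE dla linearZ. Qed.

Lemma twist_base_comm l j r :
  twist_base l (twist_base j r) = twist_base j (twist_base l r).
Proof.
by apply: tgwpa_const_inj; rewrite !twist_baseE; exact: (twist_comm sysP).
Qed.

Lemma twist_base_pder l j r :
  twist_base l (pder j r) = pder j (twist_base l r).
Proof.
apply: tgwpa_const_inj; rewrite twist_baseE.
by apply: (dtwist_pder deltaP); rewrite twist_baseE.
Qed.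

Lemma euler_comm i j (a : T) : euler i (euler j a) = euler j (euler i a).
Proof.
have EP := euler_derivation D; apply: derivations_commute_gen.
- exact: EP.
- exact: EP.
- by move=> r; rewrite !euler_const !(derivation0 (EP _)).
- by move=> l; rewrite !euler_x !(derivationZ (EP _)) !euler_x !scalerA mulrC.
- by move=> l; rewrite !euler_y !(derivationZ (EP _)) !euler_y !scalerA mulrC.
Qed.

Lemma euler_twist_comm i j (a : T) : euler i (dl j a) = dl j (euler i a).
Proof.
have EP := euler_derivation D i; have dD := (dlP j).1.
apply: derivations_commute_gen.
- exact: EP.
- exact: dD.
- by move=> r; rewrite -twist_baseE !euler_const (derivation0 dD).
- move=> l; rewrite dlx euler_x (derivationZ EP) (derivationZ dD) dlx euler_x.
  by rewrite !scalerA mulrC.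
- move=> l; rewrite dly euler_y (derivationZ EP) (derivationZ dD) dly euler_y.
  by rewrite !scalerA mulrC.
Qed.

Definition twisted_bracket : T -> T -> T :=
  wedge_sum_bracket br (@euler k n D) dl (index_enum 'I_n).

Lemma twisted_bracketP : is_poisson_bracket twisted_bracket.
Proof.
apply: wedge_sum_bracketP.
- exact: brP.
- exact: euler_bracket_derivation.
- exact: dlP.
- exact: euler_comm.
- by move=> *; exact: (twist_comm sysP).
- exact: euler_twist_comm.
Qed.

(** In degree g the i-th Euler derivation is multiplication by g_i, and [delta g] is the sum of the
    g_i [dl i], so the sum of wedges collapses to the formula of the Poisson twist. *)
Lemma twisted_bracket_homog g h (a b : T) : tgwpa_homog g a -> tgwpa_homog h b ->
  twisted_bracket a b = br a b + a * delta g b - b * delta h a.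
Proof.
move=> ga hb; rewrite /twisted_bracket /wedge_sum_bracket sumrB addrA.
rewrite !(dtwist_sum deltaP) !mulr_sumr.
congr (_ + _ - _); apply: eq_bigr => i _.
  by rewrite (euler_homog i ga) mulrzAl mulrzAr.
by rewrite (euler_homog i hb) mulrzAl mulrzAr.
Qed.

(** The twist formula fixes a bracket on homogeneous elements, and every element is a sum of
    such. *)
Lemma twisted_bracket_unique :
  unique (is_twisted_bracket (A := A) (@tgwpa_homog k n D) delta) twisted_bracket.
Proof.
have twD := pbr_derivation twisted_bracketP.
have twDl := pbr_derivation_l twisted_bracketP.
split.
  split; first exact: (pbr_bilinear twisted_bracketP).
  by move=> g h a b ga hb; rewrite (twisted_bracket_homog ga hb).
move=> tw [[twL twR] twE]; apply/funext => a; apply/funext => b.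
have tD u v w : tw (u + v) w = tw u w + tw v w.
  by have := twL w 1 u v; rewrite /= !scale1r.
have tDr u v w : tw u (v + w) = tw u v + tw u w.
  by have := twR u 1 v w; rewrite !scale1r.
elim/tgwpa_homog_ind: a => [g a ga|a a' IH IH']; last first.
  by rewrite (derivationD (twDl _)) tD IH IH'.
elim/tgwpa_homog_ind: b => [h b hb|b b' IH IH']; last first.
  by rewrite (derivationD (twD _)) tDr IH IH'.
by rewrite (twE g h) // (twisted_bracket_homog ga hb).
Qed.

Lemma twist0 (a : T) : delta 0 a = 0.
Proof.
by rewrite (dtwist_sum deltaP) big1 // => i _; rewrite mxE mulr0z.
Qed.

Lemma twistN i (a : T) : delta (- delta_mx 0 i) a = - dl i a.
Proof.
rewrite (dtwist_sum deltaP) (bigD1 i) //= big1 => [|j ji].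
  by rewrite !mxE !eqxx mulrN1z addr0.
by rewrite !mxE (negPf ji) andbF oppr0 mulr0z.
Qed.

(** The coefficient of x_j y_i in the twisted bracket of y_i and x_j, where y_i has degree -e_i. The
    new [gamma] below is the eigenvalue of a_i under the new j-th derivation. *)
Definition twist_mu i j := mu D i j - q i j - p j i.
Definition twist_gamma i j := gamma D i j - q j i - p j i.

Lemma twist_pder_prod_xy i j : i != j ->
  pder j (prod_xy D i) - twist_base j (prod_xy D i) =
  twist_gamma i j *: prod_xy D i.
Proof.
move=> ij; rewrite pder_prod_xy // twist_base_prod_xy -scalerBl.
by congr (_ *: _); rewrite /twist_gamma; ring.
Qed.

Lemma twist_pder_comm i j r :
  pder i (pder j r - twist_base j r) - twist_base i (pder j r - twist_base j r) =
  pder j (pder i r - twist_base i r) - twist_base j (pder i r - twist_base i r).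
Proof.
rewrite !(derivationB (pderP _ _).1) !(derivationB (twist_base_poisson _).1).
by rewrite (pder_comm i j) !twist_base_pder (twist_base_comm i j); ring.
Qed.

Lemma twist_gammaD_mu i j : i != j ->
  twist_gamma i j + twist_gamma j i = twist_mu i j + twist_mu j i.
Proof.
move=> ij; apply/eqP; rewrite /twist_gamma /twist_mu -subr_eq0.
rewrite -[X in _ == X](subrr (mu D i j + mu D j i)) -{1}(gammaD_mu D ij).
by apply/eqP; ring.
Qed.

Definition twist_data : tgwpa_data k n :=
  @TgwpaData k n (rank_gt0 D) R (fun i r => pder i r - twist_base i r)
    (prod_xy D) twist_mu twist_gamma
    (fun i => is_poisson_derivationB (pderP D i) (twist_base_poisson i))
    twist_pder_comm (@prod_xy_central _ _ D) (@prod_xy_regular _ _ D)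
    twist_pder_prod_xy twist_gammaD_mu.

(** The base and the a_i are unchanged, so matching generators lifts in both directions to mutually
    inverse algebra maps; only the brackets on generators have to be compared. *)
Lemma isomorphic_to_tgwpa_twist : isomorphic_to_tgwpa (PoissonAlg twisted_bracketP).
Proof.
pose D2 := twist_data.
pose c : {lrmorphism R -> T} := const.
pose c2 : {lrmorphism base D2 -> tgwpa_alg D2} := @tgwpa_const _ _ D2.
have [f [fc fx fy _]] := @tgwpa_lift _ _ D2 T c x y (tgwpa_xy D).
have [g [gc gx gy _]] :=
  @tgwpa_lift _ _ D (tgwpa_alg D2) c2 (tgwpa_x D2) (tgwpa_y D2) (tgwpa_xy D2).
have {}fc r : f (tgwpa_const (D := D2) r) = const r by exact: fc.
have {}gc r : g (const r) = tgwpa_const (D := D2) r by exact: gc.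
have fK : cancel f g.
  apply: (@tgwpa_ind _ _ D2 (fun a => g (f a) = a)) => [r|i|i|a b fa fb|a b fa fb];
    rewrite ?(fc, fx, fy) //.
    by rewrite (rmorphD f) (rmorphD g) /= fa fb.
  by rewrite (rmorphM f) (rmorphM g) /= fa fb.
have gK : cancel g f.
  apply: (@tgwpa_ind _ _ D (fun a => f (g a) = a)) => [r|i|i|a b fa fb|a b fa fb];
    rewrite ?(gc, gx, gy) //.
    by rewrite (rmorphD g) (rmorphD f) /= fa fb.
  by rewrite (rmorphM g) (rmorphM f) /= fa fb.
have hc := @tgwpa_const_homog _ _ D; have hx := tgwpa_x_homog D.
have hy := tgwpa_y_homog D.
apply: (@isomorphic_to_tgwpa_transport _ _ D2 (PoissonAlg twisted_bracketP) f).
- by exists g.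
- move=> r s; rewrite !fc /= (twisted_bracket_homog (hc r) (hc s)) !twist0.
  by rewrite !mulr0 subr0 addr0 (tbr_const brT).
- move=> r i; rewrite !fc fx /= (twisted_bracket_homog (hc r) (hx i)) twist0.
  rewrite -[delta _ _]/(dl i _) -twist_baseE (tbr_const_x brT) rmorphB /=.
  by ring.
- move=> r i; rewrite !fc fy /= (twisted_bracket_homog (hc r) (hy i)) twist0.
  rewrite twistN -twist_baseE (tbr_const_y brT) rmorphB /=.
  by ring.
(* The two twist terms contribute -(q_ii + p_ii) a_i, which is minus the value of [twist_base i] on
   a_i. *)
- move=> i; rewrite fc fx fy -[prod_xy D2 i]/(prod_xy D i).
  rewrite /= (twisted_bracket_homog (hy i) (hx i)).
  rewrite -[delta (delta_mx _ _) _]/(dl i _) twistN dlx dly (tbr_yx brT).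
  rewrite twist_base_prod_xy rmorphB /= tgwpa_constZ -tgwpa_xy.
  by rewrite scalerDl mulrN -!scalerAr [x i * _]mulrC; ring.
- move=> i j ij; rewrite !fx !fy /= /twist_mu /twist_gamma; split.
  + rewrite (twisted_bracket_homog (hy i) (hx j)) (tbr_yx_neq brT ij).
    rewrite -[delta (delta_mx _ _) _]/(dl j _) twistN dlx dly.
    by rewrite mulrN -!scalerAr [y i * _]mulrC !scalerBl.
  + rewrite (twisted_bracket_homog (hx i) (hx j)) (tbr_xx_neq brT ij).
    rewrite -[delta (delta_mx 0 i) _]/(dl i _) -[delta (delta_mx 0 j) _]/(dl j _).
    rewrite !dlx -!scalerAr [x j * _]mulrC -scalerDl -scalerBl.
    by congr (_ *: _); ring.
  + rewrite (twisted_bracket_homog (hy i) (hy j)) (tbr_yy_neq brT ij).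
    rewrite !twistN !dly !mulrN -!scalerAr [y j * _]mulrC -!scaleNr -!scalerDl.
    by congr (_ *: _); ring.
Qed.

End Twist.

(** * Invariants *)

Section Invariants.
Variables (k : fieldType) (n : nat) (D : tgwpa_data k n) (A : tgwpa D).
Variables (phi : poissonAut A) (sigma : poissonAut (base D)).
Variables (l : nat) (alpha : 'I_n -> k) (m : 'I_n -> nat).
Local Notation R := (base D).
Local Notation T := (tgwpa_alg D).
Local Notation X := (lshift n).
Local Notation Y := (@rshift n n).
Local Notation const := (@tgwpa_const k n D).
Local Notation x := (tgwpa_x D).
Local Notation y := (tgwpa_y D).
Local Notation br := (tgwpa_br A).
Local Notation S := (invariants sigma).

Hypothesis phi_const : forall r, phi (const r) = const (sigma r).
Hypothesis sigma_order : has_order sigma l.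
Hypothesis alpha0 : forall i, alpha i != 0.
Hypothesis alphaP : forall i, (m i).-primitive_root (alpha i).
Hypothesis phi_x : forall i, phi (x i) = alpha i *: x i.
Hypothesis phi_y : forall i, phi (y i) = (alpha i)^-1 *: y i.
Hypothesis coprime_lm : forall i, coprime l (m i).
Hypothesis coprime_mm : forall i j, i != j -> coprime (m i) (m j).

Let brP := tgwpa_br_poisson A.
Let brT := tgwpa_brP A.
Let der := pbr_derivation brP.
Let derl := pbr_derivation_l brP.
Let m_gt0 i : (0 < m i)%N := prim_order_gt0 (alphaP i).

Lemma sigma_prod_xy i : sigma (prod_xy D i) = prod_xy D i.
Proof.
apply: tgwpa_const_inj; rewrite -phi_const -tgwpa_xy rmorphM /= phi_x phi_y.
by rewrite -scalerAl -scalerAr scalerA mulVf // scale1r.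
Qed.

(** Multiplication by y_i turns the hypothesis into a_i r = 0. *)
Lemma tgwpa_x_regular r i : const r * x i = 0 -> r = 0.
Proof.
move=> rx; apply: (@prod_xy_regular _ _ D i); apply: tgwpa_const_inj.
by rewrite rmorphM /= -tgwpa_xy rmorph0 -mulrA [x i * _]mulrC rx mulr0.
Qed.

(** Applying [phi] to the relation for {r, x_i} gives this identity multiplied by alpha_i x_i, which
    can be cancelled. It makes [pder i] act on the invariants of the base. *)
Lemma sigma_pder i r : sigma (pder i r) = pder i (sigma r).
Proof.
have phibr a b : phi (br a b) = br (phi a) (phi b) by exact: (pautP phi).2.
have := phibr (const r) (x i); rewrite (tbr_const_x brT) rmorphM /= !phi_const.
rewrite phi_x (derivationZ (der _)) (tbr_const_x brT) -scalerAr.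
move/(scalerI (alpha0 i))/eqP; rewrite -subr_eq0 -mulrBl -rmorphB => /eqP.
by move/tgwpa_x_regular/eqP; rewrite subr_eq0 => /eqP.
Qed.

Lemma inv_pder_fixed i (r : S) : (m i)%:R *: pder i (\val r) \in fixed sigma.
Proof.
have /eqP rP := valP r; apply/eqP.
by rewrite linearZ /= sigma_pder rP.
Qed.

Definition inv_pder i (r : S) : S := InvType (inv_pder_fixed i r).

Lemma inv_prod_xy_fixed i : prod_xy D i ^+ m i \in fixed sigma.
Proof. by apply/eqP; rewrite rmorphXn /= sigma_prod_xy. Qed.

Definition inv_prod_xy i : S := InvType (inv_prod_xy_fixed i).

Definition inv_mu i j := (m i * m j)%:R * mu D i j.
Definition inv_gamma i j := (m i * m j)%:R * gamma D i j.

Lemma inv_pderP i : is_poisson_derivation (inv_pder i).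
Proof.
have [[dL dM] dbr] := is_poisson_derivationZ (m i)%:R (pderP D i).
split; [split=> [c r s|r s]|move=> r s]; apply: val_inj.
- exact: dL.
- exact: dM.
- exact: dbr.
Qed.

Lemma inv_pder_comm i j r : inv_pder i (inv_pder j r) = inv_pder j (inv_pder i r).
Proof.
apply: val_inj => /=; rewrite !(derivationZ (pderP _ _).1) pder_comm.
by rewrite !scalerA mulrC.
Qed.

Lemma inv_prod_xy_central i : poisson_central (inv_prod_xy i).
Proof.
move=> r; apply: val_inj => /=.
by rewrite (derivationXn (pbr_derivation_l (pbrP R) _)) prod_xy_central mulr0.
Qed.

Lemma inv_prod_xy_regular i : regular (inv_prod_xy i).
Proof.
move=> r /(congr1 val) /= ar0; apply: val_inj => /=.
elim: (m i) ar0 => [|j IH] ; first by rewrite mul1r.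
by rewrite exprS -mulrA => /prod_xy_regular.
Qed.

Lemma inv_pder_prod_xy i j : i != j ->
  inv_pder j (inv_prod_xy i) = inv_gamma i j *: inv_prod_xy i.
Proof.
move=> ij; apply: val_inj => /=.
rewrite (@derivation_eigenXn _ _ _ (pderP D j).1 (gamma D i j)%:A).
  rewrite -mulrA mulr_algl mulr_natl -scaler_nat !scalerA /inv_gamma natrM.
  by congr (_ *: _); ring.
by rewrite mulr_algl pder_prod_xy.
Qed.

Lemma inv_gammaD_mu i j : i != j ->
  inv_gamma i j + inv_gamma j i = inv_mu i j + inv_mu j i.
Proof.
by move=> ij; rewrite /inv_gamma /inv_mu mulnC -!mulrDr gammaD_mu.
Qed.

Definition inv_data : tgwpa_data k n :=
  TgwpaData (rank_gt0 D) inv_pderP inv_pder_comm inv_prod_xy_central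
    inv_prod_xy_regular inv_pder_prod_xy inv_gammaD_mu.

Lemma inv_x_fixed i : x i ^+ m i \in fixed phi.
Proof.
by apply/eqP; rewrite rmorphXn /= phi_x exprZn prim_expr_order ?scale1r.
Qed.

Lemma inv_y_fixed i : y i ^+ m i \in fixed phi.
Proof.
by apply/eqP; rewrite rmorphXn /= phi_y exprZn exprVn prim_expr_order ?invr1 ?scale1r.
Qed.

Lemma inv_const_fixed (r : S) : const (\val r) \in fixed phi.
Proof. by have /eqP rP := valP r; apply/eqP; rewrite phi_const rP. Qed.

Definition inv_x i : invariants phi := InvType (inv_x_fixed i).
Definition inv_y i : invariants phi := InvType (inv_y_fixed i).
Definition inv_const (r : S) : invariants phi := InvType (inv_const_fixed r).

Fact inv_const_zmod_morphism : zmod_morphism inv_const.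
Proof. by move=> r s; apply: val_inj; rewrite /= rmorphB. Qed.
Fact inv_const_monoid_morphism : monoid_morphism inv_const.
Proof. by split=> [|r s]; apply: val_inj; rewrite /= ?rmorph1 ?rmorphM. Qed.
Fact inv_const_scalable : scalable inv_const.
Proof. by move=> c r; apply: val_inj; rewrite /= linearZ. Qed.
HB.instance Definition _ :=
  GRing.isZmodMorphism.Build S (invariants phi) inv_const inv_const_zmod_morphism.
HB.instance Definition _ :=
  GRing.isMonoidMorphism.Build S (invariants phi) inv_const inv_const_monoid_morphism.
HB.instance Definition _ :=
  GRing.isScalable.Build k S (invariants phi) *:%R inv_const inv_const_scalable.

Lemma inv_xy i : inv_y i * inv_x i = inv_const (inv_prod_xy i).
Proof. by apply: val_inj; rewrite /= rmorphXn /= -tgwpa_xy exprMn. Qed.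

(** Translates exponents with respect to x_i^{m_i}, y_i^{m_i} into exponents with respect to x_i,
    y_i. *)
Definition mscale (M : 'X_{1..n + n}) : 'X_{1..n + n} :=
  [multinom (M j * paired_gens m m j)%N | j < n + n].

Lemma mscaleX M i : mscale M (X i) = (M (X i) * m i)%N.
Proof. by rewrite mnmE paired_gensX. Qed.

Lemma mscaleY M i : mscale M (Y i) = (M (Y i) * m i)%N.
Proof. by rewrite mnmE paired_gensY. Qed.

Lemma mscale_inj : injective mscale.
Proof.
move=> M N /mnmP E; apply: multinomP => i.
  have := E (X i); rewrite !mscaleX => /eqP; rewrite eqn_pmul2r; last exact: m_gt0.
  by move/eqP.
have := E (Y i); rewrite !mscaleY => /eqP; rewrite eqn_pmul2r; last exact: m_gt0.
by move/eqP.
Qed.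

Lemma mscale_reduced M : reduced M -> reduced (mscale M).
Proof.
by move=> MP i; rewrite mscaleX mscaleY; case: (MP i) => ->; [left | right].
Qed.

Lemma inv_monomial M :
  \val (mmap1 (paired_gens inv_x inv_y) M) = tgwpa_monomial D (mscale M).
Proof.
rewrite tgwpa_monomialE /mmap1 [LHS](rmorph_prod (\val : invariants phi -> T)).
rewrite big_split_ord big_split /=; congr (_ * _); apply: eq_bigr => i _.
  rewrite paired_gensX mscaleX mulnC exprM.
  exact: (rmorphXn (\val : invariants phi -> T)).
rewrite paired_gensY mscaleY mulnC exprM.
exact: (rmorphXn (\val : invariants phi -> T)).
Qed.

Lemma phi_monomial M : phi (tgwpa_monomial D M) =
  (\prod_i (alpha i ^+ M (X i) * (alpha i)^-1 ^+ M (Y i))) *: tgwpa_monomial D M.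
Proof.
rewrite !tgwpa_monomialE rmorph_prod /= -scaler_prod; apply: eq_bigr => i _.
rewrite rmorphM !rmorphXn /= phi_x phi_y !exprZn.
by rewrite -scalerAl -scalerAr scalerA.
Qed.

(* The eigenvalue of sigma on a nonzero coefficient has order dividing both l
   and a product of the m i, hence is 1; pairwise coprimality of the m i then
   makes each of its factors equal to 1. *)
Lemma fixed_exponents r M : r != 0 -> reduced M ->
  r = (\prod_i (alpha i ^+ M (X i) * (alpha i)^-1 ^+ M (Y i))) *: sigma r ->
  (forall i, (m i %| M (X i))%N /\ (m i %| M (Y i))%N) /\ sigma r = r.
Proof.
move=> r0 MP; set z := fun i => alpha i ^+ M (X i) * (alpha i)^-1 ^+ M (Y i).
set lam := \prod_i _; have -> : lam = \prod_i z i by [].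
move=> {lam} rE; have zm i : z i ^+ m i = 1.
  rewrite exprMn -!exprM ![(M _ * _)%N]mulnC !exprM exprVn.
  by rewrite (prim_expr_order (alphaP i)) invr1 !expr1n mulr1.
(* Iterating the eigenvector equation l times returns to [r], since [sigma] has order l. *)
have laml : (\prod_i z i) ^+ l = 1.
  have itl j : r = (\prod_i z i) ^+ j *: iter j sigma r.
    elim: j => [|j IH]; first by rewrite scale1r.
    by rewrite {1}rE {1}IH linearZ /= scalerA -exprS.
  have := itl l; have [_ -> _] := sigma_order.
  move/eqP; rewrite -subr_eq0 -{1}[r]scale1r -scalerBl scaler_eq0 (negPf r0) orbF.
  by rewrite subr_eq0 eq_sym => /eqP.
(* This power of the whole product is 1, and it kills every factor z_j with j different from i. *)
have zN i : z i ^+ (l * \prod_(j | j != i) m j) = 1.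
  have : (\prod_j z j) ^+ (l * \prod_(j | j != i) m j) = 1.
    by rewrite exprM laml expr1n.
  rewrite (bigD1 i) //= exprMn -prodrXl [X in _ * X]big1 ?mulr1 // => j ji.
  by rewrite (bigD1 j) //= mulnCA exprM zm expr1n.
have coN i : coprime (m i) (l * \prod_(j | j != i) m j).
  rewrite coprimeMr coprime_sym coprime_lm /=.
  elim/big_rec: _ => [|j c ji cc]; first exact: coprimen1.
  by rewrite coprimeMr cc andbT coprime_mm // eq_sym.
(* As [M] is reduced, z_i is a power of alpha_i or of its inverse; its exponent times a number
   coprime to m_i is a multiple of m_i. *)
have dvd i : (m i %| M (X i))%N /\ (m i %| M (Y i))%N.
  case: (MP i) => M0; rewrite M0 dvdn0; split=> //.
    rewrite -(Gauss_dvdl _ (coN i)) (prim_order_dvd (alphaP i)).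
    have := zN i; rewrite /z M0 mul1r -exprM exprVn => /eqP.
    by rewrite invr_eq1.
  rewrite -(Gauss_dvdl _ (coN i)) (prim_order_dvd (alphaP i)).
  by have := zN i; rewrite /z M0 mulr1 -exprM => ->.
split=> //; rewrite [RHS]rE big1 ?scale1r // => i _.
rewrite /z; have [/dvdnP[a ->] /dvdnP[b ->]] := dvd i.
rewrite ![(_ * m i)%N]mulnC !exprM exprVn (prim_expr_order (alphaP i)).
by rewrite invr1 !expr1n mulr1.
Qed.

Lemma isomorphic_to_tgwpa_invariants : isomorphic_to_tgwpa (invariants phi).
Proof.
pose D3 := inv_data.
pose c : {lrmorphism base D3 -> invariants phi} := inv_const.
have [f [fc fx fy fpi]] := @tgwpa_lift _ _ D3 _ c inv_x inv_y inv_xy.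
have {}fc r : f (tgwpa_const (D := D3) r) = inv_const r by exact: fc.
have valM (a b : invariants phi) : \val (a * b) = \val a * \val b.
  exact: (rmorphM (\val : invariants phi -> T)).
have f_monomial M : \val (f (tgwpa_monomial D3 M)) = tgwpa_monomial D (mscale M).
  by rewrite fpi mmapX inv_monomial.
have f_pi p : \val (f (tgwpa_pi p)) =
    \sum_(M <- msupp p) const (\val p@_M) * tgwpa_monomial D (mscale M).
  rewrite tgwpa_piE raddf_sum /= [LHS](raddf_sum (\val : invariants phi -> T)).
  apply: eq_bigr => M _; rewrite [in LHS]rmorphM [LHS]valM f_monomial.
  by congr (_ * _); exact: (congr1 \val (fc _)).
have f_inj : injective f.
  apply: raddf_inj => a /(congr1 \val) fa0; rewrite -[a]tgwpa_nfK.
  set p := tgwpa_nf a in fa0 *.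
  (* [Q] represents [f a] and is already reduced, so it is 0; as [mscale] is injective, its
     coefficients are those of [p]. *)
  pose Q : {mpoly R[n + n]} := \sum_(M <- msupp p) (\val p@_M : R) *: 'X_[mscale M].
  have nfQ : nf Q = Q.
    rewrite raddf_sum; apply: eq_big_seq => M /tgwpa_nf_reduced/mscale_reduced MP.
    by rewrite /= linearZ /= nfX reduced_mcancel // scale1r reduced_mred.
  have piQ : tgwpa_pi Q = 0.
    rewrite -[RHS]fa0 -[a]tgwpa_nfK -/p f_pi raddf_sum.
    by apply: eq_bigr => M _; rewrite [LHS]tgwpa_piZ.
  have Q0 : Q = 0.
    rewrite -nfQ -tgwpa_nf_pi piQ -(rmorph0 (@tgwpa_const _ _ D)).
    by rewrite tgwpa_nf_const mpolyC0.
  suff -> : p = 0 by rewrite rmorph0.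
  apply/mpolyP => M; apply: val_inj; rewrite mcoeff0 /=.
  have := congr1 (mcoeff (mscale M)) Q0; rewrite mcoeff0 => <-.
  rewrite {1}[p]mpolyE raddf_sum [LHS](raddf_sum (\val : S -> R)) /Q raddf_sum.
  apply: eq_bigr => N _ /=; rewrite !mcoeffZ !mcoeffX (inj_eq mscale_inj).
  by case: eqP => _; rewrite ?mulr1 ?mulr0.
have f_surj u : exists a, f a = u.
  pose p := tgwpa_nf (\val u).
  pose lam (M : 'X_{1..n + n}) :=
    \prod_i (alpha i ^+ M (X i) * (alpha i)^-1 ^+ M (Y i)).
  (* [Q] is the normal form of the image of [u] under [phi]. Since [u] is fixed, [Q] equals [p], and
     comparing coefficients gives the equation required by [fixed_exponents]. *)
  pose Q : {mpoly R[n + n]} := \sum_(M <- msupp p) (lam M *: sigma p@_M) *: 'X_[R, M].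
  have nfQ : nf Q = Q.
    rewrite raddf_sum; apply: eq_big_seq => M /tgwpa_nf_reduced MP.
    by rewrite /= linearZ /= nfX reduced_mcancel // scale1r reduced_mred.
  have QE : Q = p.
    rewrite -nfQ -tgwpa_nf_pi; congr tgwpa_nf.
    have /eqP <- := valP u; rewrite -[in RHS](tgwpa_nfK (\val u)) -/p.
    rewrite [in RHS]tgwpa_piE !raddf_sum; apply: eq_bigr => M _.
    rewrite [LHS]tgwpa_piZ [RHS]rmorphM /= phi_const phi_monomial.
    by rewrite tgwpa_constZ -scalerAl scalerAr.
  have pM M : M \in msupp p -> p@_M = lam M *: sigma p@_M.
    move=> Mp; rewrite -{1}QE raddf_sum (bigD1_seq M) ?msupp_uniq //=.
    rewrite mcoeffZ mcoeffX eqxx mulr1 big1 ?addr0 // => N /negPf NM.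
    by rewrite mcoeffZ mcoeffX NM mulr0.
  suff [a fa] : exists a, \val (f a) = \val u by exists a; apply: val_inj.
  rewrite -(tgwpa_nfK (\val u)) -/p tgwpa_piE big_seq.
  elim/big_rec: _ => [|M w Mp [a fa]]; first by exists 0; rewrite rmorph0.
  have [|dvd sp] := fixed_exponents _ (tgwpa_nf_reduced Mp) (pM _ Mp).
    by rewrite -mcoeff_msupp.
  have spP : p@_M \in fixed sigma by apply/eqP.
  pose M' : 'X_{1..n + n} := [multinom (M j %/ paired_gens m m j)%N | j < n + n].
  have M'E : mscale M' = M.
    apply: multinomP => i; rewrite (mscaleX, mscaleY) mnmE.
      by rewrite paired_gensX divnK //; case: (dvd i).
    by rewrite paired_gensY divnK //; case: (dvd i).
  exists (tgwpa_const (D := D3) (InvType spP) * tgwpa_monomial D3 M' + a).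
  have -> : tgwpa_monomial D M = \val (f (tgwpa_monomial D3 M')).
    by rewrite f_monomial M'E.
  by rewrite rmorphD rmorphM /= fc -fa.
have f_bij : bijective f.
  have [g gK] := choice f_surj.
  by exists g => // a; apply: f_inj; rewrite gK.
have derXl := fun a => derivation_eigenXn (derl a).
have derXr := fun a => derivation_eigenXn (der a).
(* If {u,v} is a scalar multiple of u v, passing to powers multiplies the scalar by both exponents;
   this explains the factor m_i m_j in the new scalars. *)
have brXX u v c' i j : br u v = c' *: (u * v) ->
    br (u ^+ m i) (v ^+ m j) = ((m i * m j)%:R * c') *: (u ^+ m i * v ^+ m j).
  move=> uv; rewrite (derXl _ ((m j)%:R * c'%:A * v ^+ m j)).
    have cE : ((m i * m j)%:R * c')%:A = (m i)%:R * ((m j)%:R * c'%:A) :> T.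
      by rewrite natrM -mulrA -!scalerA !scaler_nat !mulr_natl.
    by rewrite -[RHS]mulr_algl cE; ring.
  rewrite (derXr _ (c'%:A * u)) ?uv; first by ring.
  by rewrite -scalerAl mul1r scalerAl.
apply: (isomorphic_to_tgwpa_transport f_bij).
- by move=> r s; rewrite !fc; apply: val_inj; rewrite /= (tbr_const brT).
- move=> r i; rewrite !fc fx; apply: val_inj => /=.
  rewrite (derXr _ (const (pder i (\val r)))) ?(tbr_const_x brT) //.
  by rewrite linearZ /= scaler_nat mulr_natl.
- move=> r i; rewrite !fc fy; apply: val_inj => /=.
  rewrite (derXr _ (- const (pder i (\val r)))) ?(tbr_const_y brT) ?mulNr //.
  by rewrite tgwpa_constZ scaler_nat -[in RHS]mulr_natl; ring.
(* With m = m_i, {y_i^m, x_i^m} is m^2 a_i^{m-1} times the i-th derivative of a_i, which is m times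
   the derivative of a_i^m. *)
- move=> i; rewrite fc fx fy; apply: val_inj => /=.
  have yx : br (y i ^+ m i) (x i) =
      (m i)%:R * y i ^+ (m i).-1 * const (pder i (prod_xy D i)).
    by rewrite (derivationXn (derl _)) (tbr_yx brT).
  rewrite (derivationXn (der _)) yx tgwpa_constZ scaler_nat -[in RHS]mulr_natl.
  rewrite (derivationXn (pderP D i).1) !rmorphM rmorph_nat rmorphXn /=.
  by rewrite -tgwpa_xy exprMn; ring.
- move=> i j ij; rewrite !fx !fy; split; apply: val_inj => /=.
  + by rewrite (brXX _ _ (mu D i j)) 1?[x j ^+ _ * _]mulrC // (tbr_yx_neq brT ij) mulrC.
  + by rewrite (brXX _ _ _ _ _ (tbr_xx_neq brT ij)) /= /inv_gamma /inv_mu mulrBr.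
  + rewrite (brXX _ _ _ _ _ (tbr_yy_neq brT ij)) /= /inv_gamma /inv_mu mulrBr.
    by rewrite [(m j * _)%N]mulnC.
Qed.

End Invariants.

(** * Tensor products *)

Section TensorProducts.
Variables (k : fieldType) (B C T : lmodType k) (tens : B -> C -> T).
Hypothesis tensP : is_tensor_product tens.

Let bil := tens_bilinear tensP.

Lemma tensDl a b c : tens (a + b) c = tens a c + tens b c.
Proof. by have := bil.1 c 1 a b; rewrite /= !scale1r. Qed.

Lemma tensDr a b c : tens a (b + c) = tens a b + tens a c.
Proof. by have := bil.2 a 1 b c; rewrite /= !scale1r. Qed.

Lemma tens0l c : tens 0 c = 0.
Proof. by apply: (addrI (tens 0 c)); rewrite -tensDl !addr0. Qed.

Lemma tens0r b : tens b 0 = 0.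
Proof. by apply: (addrI (tens b 0)); rewrite -tensDr !addr0. Qed.

Lemma tensZl c a b : tens (c *: a) b = c *: tens a b.
Proof. by have := bil.1 b c a 0; rewrite /= tens0l !addr0. Qed.

Lemma tensZr c a b : tens a (c *: b) = c *: tens a b.
Proof. by have := bil.2 a c b 0; rewrite /= tens0r !addr0. Qed.

(* A vector outside the span of the pure tensors would be detected by a linear
   endomorphism of T vanishing on all of them. *)
Lemma tens_ind (Q : T -> Prop) :
  (forall a b, Q (tens a b)) -> (forall t u, Q t -> Q u -> Q (t + u)) ->
  forall t, Q t.
Proof.
move=> Qt QD.
pose W t := exists s : seq (B * C), t = \sum_(p <- s) tens p.1 p.2.
suff WT t : W t.
  move=> t; have [s ->] := WT t; apply: big_rec => [|p u _ Qu].
    by rewrite -(tens0l 0).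
  exact: QD.
apply: contrapT => Nt.
have WL : linear_relation (fun z : T * T => W z.1 /\ z.2 = 0).
  split=> [|c u v u' v' /= [[s ->] ->] [[s' ->] ->]|v [_ //]].
    by split=> //; exists [::]; rewrite big_nil.
  split; last by rewrite scaler0 addr0.
  exists ([seq (c *: p.1, p.2) | p <- s] ++ s'); rewrite big_cat big_map /=.
  rewrite scaler_sumr; congr (_ + _); apply: eq_bigr => p _.
  by rewrite tensZl.
have WA := @linear_relation_adjoin _ _ _ _ t t WL.
have [|g gL gE] := linear_relation_extend (WA _).
  by move=> v [/Nt].
pose G : {linear T -> T} := HB.pack g (GRing.isLinear.Build _ _ _ _ g gL).
have G0 : G =1 (\0 : {linear T -> T}).
  apply: (tens_ext tensP) => b c; apply: gE; exists 0, (tens b c).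
  rewrite !scale0r addr0 subr0; split=> //; split=> //.
  by exists [:: (b, c)]; rewrite big_seq1.
apply: Nt; exists [::]; rewrite big_nil -[RHS](G0 t).
apply/esym/gE; exists 1, 0; rewrite !scale1r add0r subrr; split=> //; split=> //.
by exists [::]; rewrite big_nil.
Qed.

Lemma tens_map (f : B -> B) (g : C -> C) : linear f -> linear g ->
  exists h : {linear T -> T}, forall b c, h (tens b c) = tens (f b) (g c).
Proof.
move=> fL gL; apply: (tens_lift tensP (f := fun b c => tens (f b) (g c))).
by split=> [c a b b'|b a c c'] /=; rewrite ?fL ?gL ?tensDl ?tensZl ?tensDr ?tensZr.
Qed.

End TensorProducts.

(** Results about the left factor thereby apply to the right factor as well. *)
Lemma is_poisson_tensor_product_swap (k : fieldType) (B C T : poissonAlg k)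
    (tens : B -> C -> T) :
  is_poisson_tensor_product tens -> is_poisson_tensor_product (fun c b => tens b c).
Proof.
move=> [tensP t1 tM tbr]; have [[bl br] lift ext] := tensP; split.
- split=> [|V f [fl fr]|V g h gh].
  + by split.
  + by have [|g gE] := lift V (fun b c => f c b); [split | exists g].
  + by apply: ext => b c; exact: gh.
- by [].
- by move=> *; exact: tM.
- by move=> c1 c2 b1 b2; rewrite tbr addrC.
Qed.

Section PoissonTensors.
Variables (k : fieldType) (B C T : poissonAlg k) (tens : B -> C -> T).
Hypothesis tensP : is_poisson_tensor_product tens.

Let tP := ptens_tensor tensP.
Let derC := pbr_derivation (pbrP C).
Let der := pbr_derivation (pbrP T).
Let derl := pbr_derivation_l (pbrP T).

(** The map induced by [d] and the identity; both product rules are additive in each argument, so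
    pure tensors suffice. *)
Lemma tens_derivation (d : B -> B) : is_poisson_derivation d ->
  exists2 e : T -> T, is_poisson_derivation e &
    forall b c, e (tens b c) = tens (d b) c.
Proof.
move=> [dP dbr]; have [|e eE] := tens_map tP (g := id) dP.1; first by [].
exists e => //; split; [split=> [c s t|]|].
- by rewrite linearP.
- apply: (tens_ind tP) => [b c|s t IHs IHt u]; last first.
    by rewrite mulrDl !raddfD /= IHs IHt mulrDl mulrDl; ring.
  apply: (tens_ind tP) => [b' c'|t u IHt IHu]; last first.
    by rewrite mulrDr !raddfD /= IHt IHu !mulrDr; ring.
  by rewrite (ptens_mul tensP) !eE !(ptens_mul tensP) (derivationM dP) (tensDl tP).
- apply: (tens_ind tP) => [b c|s t IHs IHt u]; last first.
    rewrite (derivationD (derl _)) !raddfD /= IHs IHt.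
    by rewrite !(derivationD (derl _)); ring.
  apply: (tens_ind tP) => [b' c'|t u IHt IHu]; last first.
    by rewrite (derivationD (der _)) !raddfD /= IHt IHu !(derivationD (der _)); ring.
  rewrite (ptens_br tensP) raddfD /= !eE !(ptens_br tensP) dbr (derivationM dP).
  by rewrite !(tensDl tP); ring.
Qed.

Lemma tens_central b : poisson_central b -> poisson_central (tens b 1).
Proof.
move=> bC; apply: (tens_ind tP) => [b' c'|t u IHt IHu].
  rewrite (ptens_br tensP) bC (pbr_antisym (pbrP C)) (derivation1 (derC _)).
  by rewrite oppr0 (tens0l tP) (tens0r tP) addr0.
by rewrite (derivationD (der _)) IHt IHu addr0.
Qed.

(** A linear left inverse of multiplication by [b], tensored with the identity, is a left inverse of
    multiplication by [tens b 1]: it is one on pure tensors. *)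
Lemma tens_regular b : regular b -> regular (tens b 1).
Proof.
move=> bR; have [|//|g gL gK] := @linear_left_inverse _ B B (fun r => b * r).
  by move=> c r s; rewrite mulrDr scalerAr.
have [|h hE] := tens_map tP (g := id) gL; first by [].
have hK : forall t, h (tens b 1 * t) = t.
  apply: (tens_ind tP) => [b' c|t u IHt IHu].
    by rewrite (ptens_mul tensP) mul1r hE gK.
  by rewrite mulrDr raddfD /= IHt IHu.
by move=> t bt0; rewrite -[t]hK bt0 raddf0.
Qed.

End PoissonTensors.

Section Coefficients.
Variables (k : fieldType) (n : nat) (D : tgwpa_data k n).

Definition tgwpa_coef (M : 'X_{1..n + n}) (a : tgwpa_alg D) : base D :=
  (tgwpa_nf a)@_M.

Lemma tgwpa_coef_linear M : linear (tgwpa_coef M).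
Proof.
move=> c a b; rewrite /tgwpa_coef tgwpa_nfD tgwpa_nfZ mcoeffD mcoeffZ.
by rewrite mulr_algl.
Qed.

Lemma tgwpa_coef_monomial M N r : reduced N ->
  tgwpa_coef M (tgwpa_const r * tgwpa_monomial D N) = if N == M then r else 0.
Proof.
move=> NP; rewrite /tgwpa_coef tgwpa_nf_constM tgwpa_nf_monomial //.
by rewrite mcoeffZ mcoeffX; case: eqP => _; rewrite ?mulr1 ?mulr0.
Qed.

Lemma tgwpa_coef0_const r : tgwpa_coef 0%MM (tgwpa_const r) = r.
Proof. by rewrite /tgwpa_coef tgwpa_nf_const mcoeffC eqxx mulr1. Qed.

End Coefficients.

(** * The tensor product of the bases as a Poisson subalgebra of T *)

Section TensorBase.
Variables (k : fieldType) (n m : nat).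
Variables (D : tgwpa_data k n) (A : tgwpa D) (D' : tgwpa_data k m) (A' : tgwpa D').
Variables (T : poissonAlg k) (tens : A -> A' -> T).
Hypothesis tensP : is_poisson_tensor_product tens.
Local Notation R := (base D).
Local Notation R' := (base D').
Local Notation const := (@tgwpa_const k n D).
Local Notation const' := (@tgwpa_const k m D').

Let tP := ptens_tensor tensP.

(** Taking the coefficient of the monomial 1 projects a TGWPA onto its base; the tensor product of
    two such projections cuts out the new base as its fixed points, with boolean membership. *)
Lemma tens_base_proj_subproof : exists E : {linear T -> T}, forall a b,
  E (tens a b) = tens (const (tgwpa_coef 0%MM a)) (const' (tgwpa_coef 0%MM b)).
Proof.
apply: (tens_map tP (f := const \o tgwpa_coef 0%MM) (g := const' \o tgwpa_coef 0%MM)).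
  by move=> c a b; rewrite /= tgwpa_coef_linear linearP.
by move=> c a b; rewrite /= tgwpa_coef_linear linearP.
Qed.

Definition tens_base_proj : {linear T -> T} := projT1 (cid tens_base_proj_subproof).
Local Notation E := tens_base_proj.

Lemma tens_base_projE a b :
  E (tens a b) = tens (const (tgwpa_coef 0%MM a)) (const' (tgwpa_coef 0%MM b)).
Proof. by rewrite /tens_base_proj; case: cid. Qed.

(* The image of base D (x) base D' in T. *)
Definition tens_base : {pred T} := fun t => E t == t.

Lemma tens_const_base r s : tens (const r) (const' s) \in tens_base.
Proof. by apply/eqP; rewrite tens_base_projE !tgwpa_coef0_const. Qed.

Lemma tens_base_ind (Q : T -> Prop) :
  (forall r s, Q (tens (const r) (const' s))) ->
  (forall t u, Q t -> Q u -> Q (t + u)) -> forall t, t \in tens_base -> Q t.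
Proof.
move=> Qt QD t /eqP <-; move: t.
apply: (tens_ind tP) => [a b|t u Et Eu]; first by rewrite tens_base_projE.
by rewrite raddfD; exact: QD.
Qed.

Lemma tens_baseD t u : t \in tens_base -> u \in tens_base -> t + u \in tens_base.
Proof. by move=> /eqP tE /eqP uE; apply/eqP; rewrite raddfD /= tE uE. Qed.

Fact tens_base_subalg_closed : subalg_closed tens_base.
Proof.
split=> [|c t u /eqP tE /eqP uE|t u].
- by rewrite -(ptens_1 tensP) -(rmorph1 const) -(rmorph1 const') tens_const_base.
- by apply/eqP; rewrite linearP /= tE uE.
- move=> tB uB; elim/tens_base_ind: t / tB => [r s|t t' IH IH']; last first.
    by rewrite mulrDl tens_baseD.
  elim/tens_base_ind: u / uB => [r' s'|u u' IH IH']; last first.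
    by rewrite mulrDr tens_baseD.
  rewrite (ptens_mul tensP) -[_ * const r']rmorphM -[_ * const' s']rmorphM.
  exact: tens_const_base.
Qed.
HB.instance Definition _ := GRing.isSubalgClosed.Build k T tens_base
  tens_base_subalg_closed.

Lemma tens_base_pbr t u : t \in tens_base -> u \in tens_base ->
  pbr t u \in tens_base.
Proof.
have der := pbr_derivation (pbrP T); have derl := pbr_derivation_l (pbrP T).
move=> tB uB; elim/tens_base_ind: t / tB => [r s|t t' IH IH']; last first.
  by rewrite (derivationD (derl _)) tens_baseD.
elim/tens_base_ind: u / uB => [r' s'|u u' IH IH']; last first.
  by rewrite (derivationD (der _)) tens_baseD.
rewrite (ptens_br tensP) -[_ * const r']rmorphM -[_ * const' s']rmorphM.
rewrite [@pbr _ A _ _](tbr_const (tgwpa_brP A)).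
rewrite [@pbr _ A' _ _](tbr_const (tgwpa_brP A')).
by rewrite tens_baseD ?tens_const_base.
Qed.

Record tens_base_type : Type :=
  TensBase { tens_base_val : T; _ : tens_base_val \in tens_base }.
HB.instance Definition _ := [isSub for tens_base_val].
HB.instance Definition _ := [Choice of tens_base_type by <:].
HB.instance Definition _ := [SubChoice_isSubComNzRing of tens_base_type by <:].
HB.instance Definition _ := [SubNmodule_isSubLSemiModule of tens_base_type by <:].
HB.instance Definition _ :=
  [SubNzRing_SubLmodule_isSubLalgebra of tens_base_type by <:].
HB.instance Definition _ := [SubLalgebra_isSubAlgebra of tens_base_type by <:].

Definition tens_base_br (u v : tens_base_type) : tens_base_type :=
  TensBase (tens_base_pbr (valP u) (valP v)).

Fact tens_base_br_poisson : is_poisson_bracket tens_base_br.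
Proof.
have [[bl br] alt jac der] := pbrP T.
split.
- by split=> [v c u u'|u c v v']; apply: val_inj; rewrite /= (bl, br).
- by move=> u; apply: val_inj; apply: alt.
- by move=> u v w; apply: val_inj; apply: jac.
- move=> u; split=> [c v w|v w]; apply: val_inj; first exact: br.
  exact: (der _).2.
Qed.

Definition tens_base_alg : poissonAlg k := PoissonAlg tens_base_br_poisson.

Definition tens_base_tens (r : R) (s : R') : tens_base_alg :=
  TensBase (tens_const_base r s).

Definition tens_base_incl (s : tens_base_alg) : T := \val s.
Fact tens_base_incl_zmod_morphism : zmod_morphism tens_base_incl. Proof. by []. Qed.
Fact tens_base_incl_monoid_morphism : monoid_morphism tens_base_incl. Proof. by []. Qed.
Fact tens_base_incl_scalable : scalable tens_base_incl. Proof. by []. Qed.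
HB.instance Definition _ := GRing.isZmodMorphism.Build tens_base_alg T
  tens_base_incl tens_base_incl_zmod_morphism.
HB.instance Definition _ := GRing.isMonoidMorphism.Build tens_base_alg T
  tens_base_incl tens_base_incl_monoid_morphism.
HB.instance Definition _ := GRing.isScalable.Build k tens_base_alg T *:%R
  tens_base_incl tens_base_incl_scalable.

Lemma tens_base_proj_base t : E t \in tens_base.
Proof.
move: t; apply: (tens_ind tP) => [a b|t u Et Eu].
  by rewrite tens_base_projE tens_const_base.
by rewrite raddfD tens_baseD.
Qed.

(** A bilinear map on the bases is pulled back to [A] and [A'] through the coefficients of 1, lifted
    to T, and restricted. Uniqueness holds because every element of the new base is the projection
    of an element of T, so pure tensors suffice. *)
Lemma tens_base_tensP : is_poisson_tensor_product tens_base_tens.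
Proof.
have bil : is_bilinear tens_base_tens.
  split=> [s c r r'|r c s s']; apply: val_inj; rewrite /= linearP.
    by rewrite (tensDl tP) (tensZl tP).
  by rewrite (tensDr tP) (tensZr tP).
split; first split=> //.
- move=> V f [fl fr].
  have [|g gE] :=
    tens_lift tP (f := fun a b => f (tgwpa_coef 0%MM a) (tgwpa_coef 0%MM b)).
    by split=> [b c a a'|a c b b'] /=; rewrite tgwpa_coef_linear ?fl ?fr.
  pose h (s : tens_base_alg) := g (\val s).
  have hL : linear h by move=> c s t; rewrite /h linearP.
  pose H : {linear tens_base_alg -> V} :=
    HB.pack h (GRing.isLinear.Build _ _ _ _ h hL).
  exists H => r s; by rewrite /= /h gE !tgwpa_coef0_const.
- move=> V g h gh s.
  have -> : s = TensBase (tens_base_proj_base (\val s)).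
    by apply: val_inj => /=; have /eqP := valP s.
  move: (\val s); apply: (tens_ind tP) => [a b|t u Et Eu].
    have -> : TensBase (tens_base_proj_base (tens a b)) =
        tens_base_tens (tgwpa_coef 0%MM a) (tgwpa_coef 0%MM b); last exact: gh.
    by apply: val_inj; rewrite /= tens_base_projE.
  suff -> : TensBase (tens_base_proj_base (t + u)) =
      TensBase (tens_base_proj_base t) + TensBase (tens_base_proj_base u).
    by rewrite !raddfD /= Et Eu.
  by apply: val_inj; rewrite /= raddfD.
- apply: val_inj; rewrite /= !rmorph1; exact: (ptens_1 tensP).
- move=> r r' s s'; apply: val_inj => /=.
  by rewrite (ptens_mul tensP) !rmorphM.
- move=> r r' s s'; apply: val_inj => /=.
  rewrite (ptens_br tensP) !rmorphM /=.
  by rewrite -(tbr_const (tgwpa_brP A)) -(tbr_const (tgwpa_brP A')).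
Qed.

Lemma tens_base_incl_tens r s :
  tens_base_incl (tens_base_tens r s) = tens (const r) (const' s).
Proof. by []. Qed.

End TensorBase.

(** * The TGWPA presentation of the tensor product *)

Section TensorTgwpa.
Variables (k : fieldType) (n m : nat).
Variables (D : tgwpa_data k n) (A : tgwpa D) (D' : tgwpa_data k m) (A' : tgwpa D').
Variables (T : poissonAlg k) (tens : A -> A' -> T).
Hypothesis tensP : is_poisson_tensor_product tens.
Local Notation R := (base D).
Local Notation R' := (base D').
Local Notation const := (@tgwpa_const k n D).
Local Notation const' := (@tgwpa_const k m D').
Local Notation B := (tens_base_alg tensP).
Local Notation btens := (tens_base_tens tensP).
Local Notation incl := (@tens_base_incl _ _ _ _ _ _ _ _ _ tensP).

Let tP := ptens_tensor tensP.
Let bP := tens_base_tensP tensP.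
Let btP := ptens_tensor bP.
Let derl := pbr_derivation_l (pbrP T).

Lemma tens_pder_l_subproof (i : 'I_n) : exists e : B -> B,
  is_poisson_derivation e /\ forall r s, e (btens r s) = btens (pder i r) s.
Proof. by have [e] := tens_derivation bP (pderP D i); exists e. Qed.

Lemma tens_pder_r_subproof (i : 'I_m) : exists e : B -> B,
  is_poisson_derivation e /\ forall r s, e (btens r s) = btens r (pder i s).
Proof.
have [e] := tens_derivation (is_poisson_tensor_product_swap bP) (pderP D' i).
by exists e.
Qed.

Definition tens_pder (j : 'I_(n + m)) : B -> B :=
  match split j with
  | inl i => projT1 (cid (tens_pder_l_subproof i))
  | inr i => projT1 (cid (tens_pder_r_subproof i))
  end.

Definition tens_prod_xy (j : 'I_(n + m)) : B :=
  match split j with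
  | inl i => btens (prod_xy D i) 1
  | inr i => btens 1 (prod_xy D' i)
  end.

(** Block diagonal, since generators from different factors Poisson commute. *)
Definition tens_scalars (c : 'I_n -> 'I_n -> k) (c' : 'I_m -> 'I_m -> k)
    (i j : 'I_(n + m)) : k :=
  match split i, split j with
  | inl i, inl j => c i j
  | inr i, inr j => c' i j
  | _, _ => 0
  end.

Lemma tens_pderE j r s : tens_pder j (btens r s) =
  match split j with
  | inl i => btens (pder i r) s
  | inr i => btens r (pder i s)
  end.
Proof.
by rewrite /tens_pder; case: (split j) => i; case: cid => e /= [_ ->].
Qed.

Lemma tens_pderP j : is_poisson_derivation (tens_pder j).
Proof. by rewrite /tens_pder; case: (split j) => i; case: cid => e /= []. Qed.

Lemma tens_pder_comm i j s : tens_pder i (tens_pder j s) = tens_pder j (tens_pder i s).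
Proof.
move: s; apply: (tens_ind btP) => [r s|s t IHs IHt].
  rewrite !tens_pderE; case Ei: (split i) => [i'|i']; case Ej: (split j) => [j'|j'];
    by rewrite !tens_pderE Ei Ej // pder_comm.
by rewrite !(derivationD (tens_pderP _).1) IHs IHt.
Qed.

Lemma tens_prod_xy_central i : poisson_central (tens_prod_xy i).
Proof.
rewrite /tens_prod_xy; case: (split i) => j.
  exact: (tens_central bP (@prod_xy_central _ _ _ j)).
exact: (tens_central (is_poisson_tensor_product_swap bP) (@prod_xy_central _ _ _ j)).
Qed.

Lemma tens_prod_xy_regular i : regular (tens_prod_xy i).
Proof.
rewrite /tens_prod_xy; case: (split i) => j.
  exact: (tens_regular bP (@prod_xy_regular _ _ _ j)).
exact: (tens_regular (is_poisson_tensor_product_swap bP) (@prod_xy_regular _ _ _ j)).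
Qed.

Lemma split_neq (i j : 'I_(n + m)) : i != j -> split i != split j.
Proof. by rewrite (can_eq splitK). Qed.

Lemma tens_pder_prod_xy i j : i != j -> tens_pder j (tens_prod_xy i) =
  tens_scalars (gamma D) (gamma D') i j *: tens_prod_xy i.
Proof.
move=> /split_neq; rewrite /tens_prod_xy /tens_scalars.
case Ei: (split i) => [i'|i']; case Ej: (split j) => [j'|j'] ij;
  rewrite tens_pderE Ej.
- by rewrite pder_prod_xy // (tensZl btP).
- by rewrite (derivation1 (pderP D' _).1) (tens0r btP) scale0r.
- by rewrite (derivation1 (pderP D _).1) (tens0l btP) scale0r.
- by rewrite pder_prod_xy // (tensZr btP).
Qed.

Lemma tens_gammaD_mu i j : i != j ->
  tens_scalars (gamma D) (gamma D') i j + tens_scalars (gamma D) (gamma D') j i =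
  tens_scalars (mu D) (mu D') i j + tens_scalars (mu D) (mu D') j i.
Proof.
move=> /split_neq; rewrite /tens_scalars.
case: (split i) => i'; case: (split j) => j' ij //; exact: gammaD_mu.
Qed.

Definition tens_data : tgwpa_data k (n + m) :=
  TgwpaData (ltn_addr m (rank_gt0 D)) tens_pderP tens_pder_comm
    tens_prod_xy_central tens_prod_xy_regular tens_pder_prod_xy tens_gammaD_mu.

Definition tens_x (j : 'I_(n + m)) : T :=
  match split j with
  | inl i => tens (tgwpa_x D i) 1
  | inr i => tens 1 (tgwpa_x D' i)
  end.

Definition tens_y (j : 'I_(n + m)) : T :=
  match split j with
  | inl i => tens (tgwpa_y D i) 1
  | inr i => tens 1 (tgwpa_y D' i)
  end.

Lemma tens_x_l i : tens_x (lshift m i) = tens (tgwpa_x D i) 1.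
Proof. by rewrite /tens_x -[lshift m i]/(unsplit (inl i)) unsplitK. Qed.

Lemma tens_x_r i : tens_x (rshift n i) = tens 1 (tgwpa_x D' i).
Proof. by rewrite /tens_x -[rshift n i]/(unsplit (inr i)) unsplitK. Qed.

Lemma tens_y_l i : tens_y (lshift m i) = tens (tgwpa_y D i) 1.
Proof. by rewrite /tens_y -[lshift m i]/(unsplit (inl i)) unsplitK. Qed.

Lemma tens_y_r i : tens_y (rshift n i) = tens 1 (tgwpa_y D' i).
Proof. by rewrite /tens_y -[rshift n i]/(unsplit (inr i)) unsplitK. Qed.

Let tM := ptens_mul tensP.

Lemma tens_xy j : tens_y j * tens_x j = incl (tens_prod_xy j).
Proof.
rewrite /tens_y /tens_x /tens_prod_xy; case: (split j) => i.
  by rewrite tM mulr1 [X in tens X _]tgwpa_xy -(rmorph1 const').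
by rewrite tM mulr1 [X in tens _ X]tgwpa_xy -(rmorph1 const).
Qed.

Definition mleft (M : 'X_{1..(n + m) + (n + m)}) : 'X_{1..n + n} :=
  [multinom M (paired_gens (fun i : 'I_n => lshift (n + m) (lshift m i))
                 (fun i => rshift (n + m) (lshift m i)) j) | j < n + n].

Definition mright (M : 'X_{1..(n + m) + (n + m)}) : 'X_{1..m + m} :=
  [multinom M (paired_gens (fun i : 'I_m => lshift (n + m) (rshift n i))
                 (fun i => rshift (n + m) (rshift n i)) j) | j < m + m].

Lemma mleft_reduced M : reduced M -> reduced (mleft M).
Proof. by move=> MP i; rewrite !mnmE paired_gensX paired_gensY; exact: MP. Qed.

Lemma mright_reduced M : reduced M -> reduced (mright M).
Proof. by move=> MP i; rewrite !mnmE paired_gensX paired_gensY; exact: MP. Qed.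

Lemma mleft_mright_eq M N :
  (M == N) = (mleft M == mleft N) && (mright M == mright N).
Proof.
apply/eqP/andP=> [-> //|[/eqP/mnmP El /eqP/mnmP Er]].
apply: multinomP => i; rewrite -[i]splitK; case: (split i) => j /=.
- by have := El (lshift n j); rewrite !mnmE paired_gensX.
- by have := Er (lshift m j); rewrite !mnmE paired_gensX.
- by have := El (rshift n j); rewrite !mnmE paired_gensY.
- by have := Er (rshift m j); rewrite !mnmE paired_gensY.
Qed.

Fact tensl_is_monoid_morphism : monoid_morphism (fun a : A => tens a 1).
Proof. by split=> [|a b]; [exact: ptens_1 | rewrite tM mulr1]. Qed.

Fact tensr_is_monoid_morphism : monoid_morphism (fun b : A' => tens 1 b).
Proof. by split=> [|a b]; [exact: ptens_1 | rewrite tM mulr1]. Qed.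

Lemma tens_monomial M :
  mmap1 (paired_gens tens_x tens_y) M =
  tens (tgwpa_monomial D (mleft M)) (tgwpa_monomial D' (mright M)).
Proof.
have [l1 lM] := tensl_is_monoid_morphism; have [r1 rM] := tensr_is_monoid_morphism.
have lX a j : tens (a ^+ j) 1 = tens a 1 ^+ j.
  by elim: j => [|j IH]; rewrite ?expr0 // !exprS lM IH.
have rX a j : tens 1 (a ^+ j) = tens 1 a ^+ j.
  by elim: j => [|j IH]; rewrite ?expr0 // !exprS rM IH.
rewrite -[tgwpa_monomial D _]mulr1 -[tgwpa_monomial D' _]mul1r -tM.
rewrite !tgwpa_monomialE (big_morph _ lM l1) (big_morph _ rM r1).
rewrite mmap1_paired_gens big_split_ord; congr (_ * _).
  apply: eq_bigr => i _; rewrite lM !lX !mnmE.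
  by rewrite paired_gensX paired_gensY tens_x_l tens_y_l.
apply: eq_bigr => i _; rewrite rM !rX !mnmE.
by rewrite paired_gensX paired_gensY tens_x_r tens_y_r.
Qed.

(** The coefficient maps of the two factors at the two halves of [N], tensored together. They show
    that the reduced monomials in [tens_x], [tens_y] are independent over the new base. *)
Lemma tens_coef (N : 'X_{1..(n + m) + (n + m)}) : exists C : {linear T -> B},
  forall M s, reduced M ->
    C (incl s * tens (tgwpa_monomial D (mleft M)) (tgwpa_monomial D' (mright M))) =
      if M == N then s else 0.
Proof.
have [|C CE] := tens_lift tP
  (f := fun a b => btens (tgwpa_coef (mleft N) a) (tgwpa_coef (mright N) b)).
  split=> [b c a a'|a c b b'] /=; rewrite tgwpa_coef_linear.
    by rewrite (tensDl btP) (tensZl btP).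
  by rewrite (tensDr btP) (tensZr btP).
exists C => M s MP; move: s; apply: (tens_ind btP) => [r s|s t IHs IHt]; last first.
  by rewrite raddfD /= mulrDl raddfD /= IHs IHt; case: eqP; rewrite ?addr0.
rewrite tens_base_incl_tens tM CE !tgwpa_coef_monomial; first last.
- exact: mleft_reduced.
- exact: mright_reduced.
rewrite mleft_mright_eq; do 2?case: eqP => _ //=.
- exact: (tens0r btP).
- exact: (tens0l btP).
- exact: (tens0l btP).
Qed.

Lemma isomorphic_to_tgwpa_tensor : isomorphic_to_tgwpa T.
Proof.
pose c : {lrmorphism base tens_data -> T} := incl.
have [f [fc fx fy fpi]] := @tgwpa_lift _ _ tens_data T c tens_x tens_y tens_xy.
have {}fc r : f (tgwpa_const (D := tens_data) r) = incl r by exact: fc.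
have f_inj : injective f.
  apply: raddf_inj => a fa0; rewrite -[a]tgwpa_nfK.
  suff -> : tgwpa_nf a = 0 by rewrite rmorph0.
  apply/mpolyP => N; rewrite mcoeff0.
  have [Np|/memN_msupp_eq0 //] := boolP (N \in msupp (tgwpa_nf a)).
  (* [C] is controlled on reduced monomials, and a normal form contains no others; applied to [f a]
     it returns the coefficient at [N]. *)
  have [C CE] := tens_coef N.
  have fa : f a = mmap c (paired_gens tens_x tens_y) (tgwpa_nf a).
    by rewrite -{1}[a]tgwpa_nfK fpi.
  have := congr1 C (etrans (esym fa) fa0); rewrite raddf0 /mmap raddf_sum.
  rewrite (bigD1_seq N) ?msupp_uniq //= tens_monomial CE ?eqxx; last first.
    exact: tgwpa_nf_reduced Np.
  rewrite big_seq_cond big1 ?addr0 => [//|M /andP[Mp /negPf MN]].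
  rewrite tens_monomial CE ?MN //; exact: (@tgwpa_nf_reduced _ _ tens_data a M Mp).
have f_surj : forall t, exists a, f a = t.
  apply: (tens_ind tP) => [a b|t u [a <-] [b <-]]; last first.
    by exists (a + b); rewrite rmorphD.
  (* A pure tensor is the product of [tens a 1] and [tens 1 b], and each of these is reached by
     induction on the generators of its factor. *)
  have [u fu] : exists u, f u = tens a 1.
    move: a; apply: (@tgwpa_ind _ _ D (fun a => exists u, f u = tens a 1)).
    - move=> r; exists (tgwpa_const (D := tens_data) (btens r 1)).
      by rewrite fc tens_base_incl_tens rmorph1.
    - by move=> i; exists (tgwpa_x tens_data (lshift m i)); rewrite fx tens_x_l.
    - by move=> i; exists (tgwpa_y tens_data (lshift m i)); rewrite fy tens_y_l.
    - by move=> a a' [u fu] [v fv]; exists (u + v);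
      rewrite rmorphD /= fu fv -(tensDl tP).
    - by move=> a a' [u fu] [v fv]; exists (u * v); rewrite rmorphM /= fu fv tM mulr1.
  have [v fv] : exists v, f v = tens 1 b.
    move: b; apply: (@tgwpa_ind _ _ D' (fun b => exists v, f v = tens 1 b)).
    - move=> r; exists (tgwpa_const (D := tens_data) (btens 1 r)).
      by rewrite fc tens_base_incl_tens rmorph1.
    - by move=> i; exists (tgwpa_x tens_data (rshift n i)); rewrite fx tens_x_r.
    - by move=> i; exists (tgwpa_y tens_data (rshift n i)); rewrite fy tens_y_r.
    - by move=> b b' [v fv] [w fw]; exists (v + w);
      rewrite rmorphD /= fv fw -(tensDr tP).
    - by move=> b b' [v fv] [w fw]; exists (v * w); rewrite rmorphM /= fv fw tM mulr1.
  by exists (u * v); rewrite rmorphM /= fu fv tM mulr1 mul1r.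
have f_bij : bijective f.
  have [g gK] := choice f_surj.
  by exists g => // a; apply: f_inj; rewrite gK.
have tbr := ptens_br tensP.
have br1 (P : poissonAlg k) (u : P) : pbr u 1 = 0.
  exact: (derivation1 (pbr_derivation (pbrP P) u)).
have br1l (P : poissonAlg k) (u : P) : pbr 1 u = 0.
  exact: (derivation1 (pbr_derivation_l (pbrP P) u)).
have brT := tgwpa_brP A; have brT' := tgwpa_brP A'.
have tN a b : tens (- a) b = - tens a b by rewrite -scaleN1r (tensZl tP) scaleN1r.
have tNr a b : tens a (- b) = - tens a b by rewrite -scaleN1r (tensZr tP) scaleN1r.
apply: (isomorphic_to_tgwpa_transport f_bij).
- by move=> r s; rewrite !fc.
- move=> s i; rewrite !fc fx -[pder i s]/(tens_pder i s); move: s.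
  apply: (tens_ind btP) => [r s|s t IHs IHt]; last first.
    rewrite (derivationD (tens_pderP i).1) !raddfD /= (derivationD (derl _)) IHs IHt.
    by rewrite mulrDl.
  rewrite tens_pderE /tens_x; case: (split i) => j.
    rewrite !tens_base_incl_tens tbr br1 (tens0r tP) addr0 tM !mulr1.
    by congr (tens _ _); exact: (tbr_const_x brT).
  rewrite !tens_base_incl_tens tbr br1 (tens0l tP) add0r tM !mulr1.
  by congr (tens _ _); exact: (tbr_const_x brT').
- move=> s i; rewrite !fc fy -[pder i s]/(tens_pder i s); move: s.
  apply: (tens_ind btP) => [r s|s t IHs IHt]; last first.
    rewrite (derivationD (tens_pderP i).1) !raddfD /= (derivationD (derl _)) IHs IHt.
    by rewrite mulrDl opprD.
  rewrite tens_pderE /tens_y; case: (split i) => j.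
    rewrite !tens_base_incl_tens tbr br1 (tens0r tP) addr0 tM !mulr1 -tN.
    by congr (tens _ _); exact: (tbr_const_y brT).
  rewrite !tens_base_incl_tens tbr br1 (tens0l tP) add0r tM !mulr1 -tNr.
  by congr (tens _ _); exact: (tbr_const_y brT').
- move=> i; rewrite fx fy fc -[prod_xy _ i]/(tens_prod_xy i).
  rewrite -[pder _ _]/(tens_pder i _).
  rewrite /tens_prod_xy /tens_x /tens_y; case Ei: (split i) => [j|j].
    rewrite tens_pderE Ei tens_base_incl_tens tbr br1 (tens0r tP) addr0 mulr1 rmorph1.
    by congr (tens _ _); exact: (tbr_yx brT).
  rewrite tens_pderE Ei tens_base_incl_tens tbr br1 (tens0l tP) add0r mulr1 rmorph1.
  by congr (tens _ _); exact: (tbr_yx brT').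
- move=> i j /split_neq; rewrite !fx !fy /= /tens_scalars /tens_x /tens_y.
  (* In the mixed cases both sides are 0: brackets with 1 vanish, and so do the scalars. The two
     remaining cases are the relations of [A] and of [A']. *)
  case: (split i) => i'; case: (split j) => j' ij; rewrite !tbr !tM ?br1 ?br1l;
    rewrite ?(tens0l tP) ?(tens0r tP) ?addr0 ?add0r ?mulr1 ?oppr0 ?scale0r //.
    rewrite -!(tensZl tP); split.
    + exact: (congr1 (tens^~ 1) (tbr_yx_neq brT ij)).
    + exact: (congr1 (tens^~ 1) (tbr_xx_neq brT ij)).
    + exact: (congr1 (tens^~ 1) (tbr_yy_neq brT ij)).
  rewrite -!(tensZr tP); split.
  + exact: (congr1 (tens 1) (tbr_yx_neq brT' ij)).
  + exact: (congr1 (tens 1) (tbr_xx_neq brT' ij)).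
  + exact: (congr1 (tens 1) (tbr_yy_neq brT' ij)).
Qed.

End TensorTgwpa.

Theorem theorem2 (k : fieldType) (n m : nat)
    (D : tgwpa_data k n) (A : tgwpa D) (D' : tgwpa_data k m) (A' : tgwpa D') :
  [/\ (* (1) *)
      forall (T : poissonAlg k) (tens : A -> A' -> T),
        is_poisson_tensor_product tens -> isomorphic_to_tgwpa T,
      (* (2) *)
      forall delta : 'rV[int]_n -> A -> A,
        is_diagonal_twisting_system delta ->
        exists (tw : A -> A -> A) (twP : is_poisson_bracket tw),
          unique (is_twisted_bracket (A := A) (@tgwpa_homog k n D) delta) tw /\
          isomorphic_to_tgwpa (PoissonAlg twP)
    & (* (3) *)
      forall phi : poissonAut A,
        is_diagonal_automorphism phi -> isomorphic_to_tgwpa (invariants phi)].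
Proof.
split=> [T tens tensP|delta deltaP|phi].
- exact: isomorphic_to_tgwpa_tensor tensP.
- have [q [p qpP]] := dtwist_diag deltaP.
  have dlx l j : delta (delta_mx 0 l) (tgwpa_x D j) = q l j *: tgwpa_x D j.
    by case: (qpP l j).
  have dly l j : delta (delta_mx 0 l) (tgwpa_y D j) = p l j *: tgwpa_y D j.
    by case: (qpP l j).
  have dla l j : delta (delta_mx 0 l) (tgwpa_const (prod_xy D j)) =
      (q l j + p l j) *: tgwpa_const (prod_xy D j).
    by case: (qpP l j).
  exists (twisted_bracket A delta), (twisted_bracketP deltaP dlx dly); split.
    exact: (twisted_bracket_unique deltaP dlx dly).
  exact: isomorphic_to_tgwpa_twist dla.
- move=> [sigma [l [alpha [m' [[phic sl] phixy lm mm]]]]].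
  apply: (@isomorphic_to_tgwpa_invariants _ _ _ _ phi sigma l alpha m') => // i;
    by case: (phixy i).
Qed.
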